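(* Let $RT$ be a group of Riemannian translations on $X$, and let $DR$ be a group of motions of the tangent bundle of the Riemannian space, associated with $RT$, acting in the tangent bundle $TX$ by $\tau'_x=r_x\langle\pi_x(t_x)\langle\tau_{x'}\rangle\rangle$. Then: (i) the translation generators of this action are the covariant derivatives of vector fields: for $l\in T$, $D_x\langle(l,0)\rangle=\nabla_l:=e_l+\gamma_x\langle l,\cdot\rangle$; (ii) the structure operator $\Sigma_x$ of $DR$ has as components the anholonomity object $C_x$ of the orthonormal frame field $e_x$ and the curvature tensor $R_x$ in this frame: for $l,l'\in T$, the $T$-component of $\Sigma_x\langle(l,0),(l',0)\rangle$ is $C_x\langle l,l'\rangle$, and its rotation component is the endomorphism $\theta\mapsto R_x\langle\theta,l,l'\rangle$ of $T$; (iii) the structure equation of the Riemannian space $$\nabla_l\nabla_{l'}-\nabla_{l'}\nabla_l=\nabla_{C_x\langle l,l'\rangle}+R_x\langle\cdot,l,l'\rangle\qquad(l,l'\in T)$$ is a necessary condition for the existence of the group $DR$, i.e. it holds whenever $DR$ exists; $DR$ defines this structure on $X$ by its action in $TX$.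
   Context: All considerations are local: points are taken sufficiently close, so that any two of them are joined by a unique (short) geodesic, and parameters are small. $X$ is an open coordinate domain, regarded as a domain of a finite-dimensional real affine space with translation vector space $\widetilde T$; $T$ is a real vector space isomorphic to $\widetilde T$, with a fixed Euclidean metric $\eta$. **Deformed group $T_X^{gH}$.** A deformation is a family of maps $H_x:\widetilde T\to T$, $x\in X$, smooth in all variables, each a (local, near $0$) diffeomorphism with $H_x(0)=0$; $K_x:=H_x^{-1}$, $h_x:=DH_x(0)$, $k_x:=h_x^{-1}$. $T_X^{gH}$ is the (local) group of smooth functions $x\mapsto t_x\in T$ for which $x\mapsto x+K_x(t_x)$ has invertible derivative, with multiplication $(t\times t')_x=\varphi_x(t_x,t'_{x'})$, $\varphi_x(t,t'):=H_x(K_x(t)+K_{x'}(t'))$, $x'=x+K_x(t)$, and action $x\mapsto x+K_x(t_x)$ on $X$. For $l\in T$, $e_l$ is the vector field (differential operator) on $X$ in the direction $k_x\langle l\rangle$; these form the frame field $e_x$. With $\partial,\partial'$ the derivatives in the first and second argument of $\varphi_x$: $\gamma_x:=\partial\partial'\varphi_x(0,0)$, $C_x\langle l,l'\rangle:=\gamma_x\langle l,l'\rangle-\gamma_x\langle l',l\rangle$ (one has $[e_l,e_{l'}]=e_{C_x\langle l,l'\rangle}$), $\rho_x:=\partial\partial'^2\varphi_x(0,0)$, $R_x\langle t,l',l\rangle:=\rho_x\langle l,l',t\rangle-\rho_x\langle l',l,t\rangle$ (first slots of $\gamma_x$, $\rho_x$ refer to the first argument of $\varphi_x$). The group defines on $X$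 the torsion-free connection $\nabla_l=e_l+\gamma_x\langle l,\cdot\rangle$ acting on functions $X\to T$ (components of vector fields in the frame $e_x$), equivalently the connection with coefficients $\Gamma_x:=k_x\circ D^2H_x(0)$ in the holonomic frame. **Group $RT$.** $T_X^{gH}$ is canonical if for any two points $x,x'\in X$ there is a smooth parametric curve $x(s)$ through them, starting at $x(0)=x$, such that, with $\tau_{x(s)}:=h_{x(s)}\langle\dot x(s)\rangle$ and $x'=x(s)$, $\varphi_x(s\tau_x,s'\tau_{x'})=(s+s')\tau_x$ for all (admissible) $s,s'$; such curves are geodesics of $\Gamma$. A group of Riemannian translations $RT$ is a canonical $T_X^{gH}$ with $\eta\langle\tau_x,\tau_x\rangle=\eta\langle\tau_{x'},\tau_{x'}\rangle$ along these geodesics. It defines the metric $g_x\langle\tilde\tau,\tilde\tau\rangle=\eta\langle h_x\langle\tilde\tau\rangle,h_x\langle\tilde\tau\rangle\rangle$, for which $e_x$ is orthonormal. **Group $DR$.** Let $R$ be the group of linear maps of $T$ preserving $\eta$, and $R^g$ the group of smooth functions $x\mapsto r_x\in R$. Let $\bar H$ be a deformation, i.e. a family of maps $\bar H_x:\widetilde T\to T$, $x\in X$, smooth in all variables, each a (local, near $0$) diffeomorphism with $\bar H_x(0)=0$; $\bar K_x:=\bar H_x^{-1}$, and let $\pi_x(t)\in R$ depend smoothly on $(x,t)$ with $\pi_x(0)=1$. The deformed group $G_X^{g\bar H}$ consists of pairs $\vartheta_x=(t_x,r_x)$ (with $t$ an element of $T_X^{g\bar H}$, the group defined as $T_X^{gH}$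 but with $\bar H$, $\bar K$ in place of $H$, $K$; $r\in R^g$) with multiplication $(\vartheta\times\vartheta')_x=\Phi_x(\vartheta_x,\vartheta'_{x'})$, $x'=x+\bar K_x(t_x)$, where $$\Phi_x^T(\vartheta,\vartheta')=\bar\varphi_x(t,t'):=\bar H_x(\bar K_x(t)+\bar K_{x'}(t')),\qquad \Phi_x^R(\vartheta,\vartheta')=r\circ\pi_x(t)\circ r'\circ\pi_{x'}(t')\circ\pi_x(\bar\varphi_x(t,t'))^{-1}.$$ It acts on $X$ by $x\mapsto x'=x+\bar K_x(t_x)$ and in $TX$ (vector fields given by components $\tau_x\in T$ in the frame) by $\tau'_x=L_x(\vartheta_x)\langle\tau_{x'}\rangle$, $L_x(\vartheta):=r\circ\pi_x(t)$. The group of motions of the tangent bundle of the Riemannian space, $DR$, associated with $RT$ is such a group satisfying the consistency condition $\bar\nabla_x=\nabla_x$, i.e. $D\bar K_x(0)=k_x$ and $\bar\gamma_x:=\partial\pi_x(0)=\gamma_x$ (meaning $\frac{d}{d\epsilon}\pi_x(\epsilon l)\langle\theta\rangle|_{\epsilon=0}=\gamma_x\langle l,\theta\rangle$). **Generators and structure operator of $DR$.** With $\xi$ ranging over the tangent space at the unit $(0,1)$ of $T\times R$: $D_x\langle\xi\rangle\tau_x:=\partial_\vartheta\big(L_x(\vartheta)\langle\tau_{x'}\rangle\big)|_{\vartheta=(0,1)}\langle\xi\rangle$ with $x'=x+\bar K_x(t)$; $\Lambda_x(\vartheta):=\partial_{\vartheta'}\Phi_x(\vartheta,\vartheta')|_{\vartheta'=(0,1)}$;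 $\Sigma_x\langle\xi,\xi'\rangle:=\partial_\vartheta\Lambda_x(\vartheta)\langle\xi,\xi'\rangle|_{\vartheta=(0,1)}-(\xi\leftrightarrow\xi')$, where $\xi$ is the direction of differentiation in $\vartheta$ and $\xi'$ the argument of $\Lambda_x$. *)

(* Defs.v *)
From HB Require Import structures.
From mathcomp Require Export all_boot all_order all_algebra.
From mathcomp Require Export all_classical all_reals all_analysis.
Set Implicit Arguments.
Unset Strict Implicit.
Unset Printing Implicit Defensive.
Export Order.TTheory GRing.Theory Num.Theory.
Export numFieldNormedType.Exports.
Local Open Scope classical_set_scope.
Local Open Scope ring_scope.

(* C^k and C^oo on a set U (open in all uses below), for maps between
   finite-dimensional spaces. *)
Fixpoint Ck {R : realType} {V W : normedModType R} (k : nat) (U : set V)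
    (f : V -> W) : Prop :=
  if k is k'.+1 then
    (forall x, U x -> differentiable f x) /\
    (forall v : V, Ck k' U (fun x => 'D_v f x))
  else forall x, U x -> {for x, continuous f}.

Definition smooth {R : realType} {V W : normedModType R} (U : set V)
  (f : V -> W) : Prop := forall k, Ck k U f.

Section Euclidean.
Context {R : realType} {n : nat}.
Implicit Types (eta A : 'M[R]_n) (u v : 'cV[R]_n).

Definition inner eta u v : R := (u^T *m eta *m v) ord0 ord0.

Definition euclidean_metric eta : Prop :=
  eta^T = eta /\ forall v, v != 0 -> 0 < inner eta v v.

Definition rotation eta A : Prop :=
  forall u v, inner eta (A *m u) (A *m v) = inner eta u v.

End Euclidean.

(* Bases are fixed in the translation space of X, written E, and in the
   parameter space T; both are then 'cV[R]_n, and linear endomorphisms are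
   matrices acting on the left. *)
Section Deformation.
Context {R : realType} {n : nat}.
Local Notation E := 'cV[R]_n (only parsing).
Local Notation T := 'cV[R]_n (only parsing).

(* H and K are total functions whose values matter only on explicit domains:
   domH is an open neighbourhood of the zero section of X * E, and each H x is
   a diffeomorphism from the fibre of domH over x onto an open subset of T,
   with inverse K x. *)
Record deformation (X : set E) := Deformation {
  Hmap : E -> E -> T ;
  Kmap : E -> T -> E ;
  domH : set (E * E) ;
  domH_open : open domH ;
  domH_sub : forall x y, domH (x, y) -> X x ;
  domH_zero : forall x, X x -> domH (x, 0) ;
  Hmap_zero : forall x, X x -> Hmap x 0 = 0 ;
  Hmap_smooth : smooth domH (fun p : E * E => Hmap p.1 p.2) ;
  Hmap_image_open :
    forall x, X x -> open (Hmap x @` [set y | domH (x, y)]) ;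
  HmapK : forall x y, domH (x, y) -> Kmap x (Hmap x y) = y ;
  Kmap_smooth :
    forall x, X x -> smooth (Hmap x @` [set y | domH (x, y)]) (Kmap x)
}.

Section Structure.
Context {X : set E} (D : deformation X).

Definition domK (x : E) : set T := Hmap D x @` [set y | domH D (x, y)].

Definition target (x : E) (t : T) : E := x + Kmap D x t.

Definition phi (x : E) (t t' : T) : T :=
  Hmap D x (Kmap D x t + Kmap D (target x t) t').

Definition hmx (x : E) : 'M[R]_n :=
  \matrix_(i, j) ('D_(delta_mx j ord0) (Hmap D x) 0) i ord0.

Definition kmx (x : E) : 'M[R]_n := invmx (hmx x).

Definition frame_field (l : T) {W : normedModType R} (f : E -> W) (x : E) : W :=
  'D_(kmx x *m l) f x.

Definition gamma (x : E) (l l' : T) : T :=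
  'D_l (fun t => 'D_l' (fun t' => phi x t t') 0) 0.

(* The first slot is the derivative in the first argument of phi, the last two
   are the second derivative in its second argument. *)
Definition rho (x : E) (l a b : T) : T :=
  'D_l (fun t => 'D_a (fun s => 'D_b (fun t' => phi x t t') s) 0) 0.

Definition anholonomy (x : E) (l l' : T) : T := gamma x l l' - gamma x l' l.

Definition curvature (x : E) (t l' l : T) : T := rho x l l' t - rho x l' l t.

(* Acts on components tau : X -> T of vector fields in the frame. *)
Definition nabla (l : T) (tau : E -> T) (x : E) : T :=
  frame_field l tau x + gamma x l (tau x).

Definition velocity (c : R -> E) (s : R) : T := hmx (c s) *m c^`()%classic s.

(* A smooth curve in X starting at c 0 with
   phi_x(s tau_x, s' tau_x') = (s + s') tau_x, where x = c 0 and the point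
   x' = x + K_x(s tau_x) reached from x is c s.  The admissible parameters
   are those for which s and s + s' stay in the interval J of the curve; all
   the terms of the equation are then required to be defined. *)
Definition group_geodesic (c : R -> E) (J : set R) : Prop :=
  [/\ [/\ open J, is_interval J & J 0],
      smooth J c,
      forall s, J s ->
        [/\ X (c s), domK (c 0) (s *: velocity c 0)
          & target (c 0) (s *: velocity c 0) = c s] &
      forall s s', J s -> J (s + s') ->
        [/\ domK (c s) (s' *: velocity c s),
            domH D (c 0, Kmap D (c 0) (s *: velocity c 0)
                         + Kmap D (c s) (s' *: velocity c s))
          & phi (c 0) (s *: velocity c 0) (s' *: velocity c s)
            = (s + s') *: velocity c 0]].

(* The condition is local: it concerns any two sufficiently close points. *)
Definition canonical : Prop :=
  forall x0, X x0 -> \forall p \near (x0, x0),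
    exists (c : R -> E) (J : set R),
      [/\ group_geodesic c J, c 0 = p.1 & exists2 s, J s & c s = p.2].

End Structure.

Record riemannian_translations (X : set E) (eta : 'M[R]_n) :=
  RiemannianTranslations {
  RT_deformation :> deformation X ;
  RT_canonical : canonical RT_deformation ;
  RT_isometric : forall c J, group_geodesic RT_deformation c J ->
    forall s, J s ->
      inner eta (velocity RT_deformation c s) (velocity RT_deformation c s)
      = inner eta (velocity RT_deformation c 0) (velocity RT_deformation c 0)
}.

(* The data (Hbar, pi) of the group of pairs (t_x, r_x); pi is meaningful on
   an open neighbourhood domP of the zero section of X * T. *)
Record bundle_motions (X : set E) (eta : 'M[R]_n) := BundleMotions {
  BM_deformation :> deformation X ;
  pi_ : E -> T -> 'M[R]_n ;
  domP : set (E * T) ;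
  domP_open : open domP ;
  domP_sub : forall x t, domP (x, t) -> X x ;
  domP_zero : forall x, X x -> domP (x, 0) ;
  pi_smooth : smooth domP (fun p : E * T => pi_ p.1 p.2) ;
  pi_rotation : forall x t, domP (x, t) -> rotation eta (pi_ x t) ;
  pi_zero : forall x, X x -> pi_ x 0 = 1%:M
}.

(* The group T * R is viewed inside T * 'M_n, to which Phi and L extend by the
   same formulas; derivatives along vectors tangent to T * R at (0, 1) may be
   taken in this ambient space. *)
Section Motions.
Context {X : set E} {eta : 'M[R]_n} (G : bundle_motions X eta).
Local Notation TR := ('cV[R]_n * 'M[R]_n)%type (only parsing).

Definition unitTR : TR := (0, 1%:M).

Definition PhiT (x : E) (th th' : TR) : T := phi G x th.1 th'.1.

Definition PhiR (x : E) (th th' : TR) : 'M[R]_n :=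
  th.2 *m pi_ G x th.1 *m th'.2 *m pi_ G (target G x th.1) th'.1
  *m invmx (pi_ G x (phi G x th.1 th'.1)).

Definition Phi (x : E) (th th' : TR) : TR := (PhiT x th th', PhiR x th th').

Definition Lmx (x : E) (th : TR) : 'M[R]_n := th.2 *m pi_ G x th.1.

(* The gauge group itself; its structure enters the generators and the
   structure operator through Phi and L only. *)
Definition gauge_element (th : E -> TR) : Prop :=
  smooth X th /\ forall x, X x ->
    [/\ domK G x (th x).1, domP G (x, (th x).1), rotation eta (th x).2
      & injective ('d (fun y => target G y (th y).1) x)].

Definition gauge_mul (th th' : E -> TR) (x : E) : TR :=
  Phi x (th x) (th' (target G x (th x).1)).

Definition act_TX (th : E -> TR) (tau : E -> T) (x : E) : T :=
  Lmx x (th x) *m tau (target G x (th x).1).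

(* The transformed field at x depends on the group element only through its
   value at x, so constant families suffice. *)
Definition generator (xi : E -> TR) (tau : E -> T) (x : E) : T :=
  'D_(xi x) (fun th : TR => act_TX (fun=> th) tau x) unitTR.

Definition Lambda (x : E) (th xi' : TR) : TR :=
  'D_xi' (fun th' : TR => Phi x th th') unitTR.

Definition Sigma (x : E) (xi xi' : TR) : TR :=
  'D_xi (fun th : TR => Lambda x th xi') unitTR
  - 'D_xi' (fun th : TR => Lambda x th xi) unitTR.

(* The consistency condition: D Kbar_x(0) = k_x and the derivative of pi_x at 0
   is gamma_x. *)
Definition associated (RT : riemannian_translations X eta) : Prop :=
  forall x, X x ->
    (forall l : T, 'D_l (Kmap G x) 0 = kmx RT x *m l) /\
    (forall l theta : T, 'D_l (pi_ G x) 0 *m theta = gamma RT x l theta).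

End Motions.
End Deformation.

(* Main.v *)
From HB Require Import structures.
Require Import Defs.
From mathcomp Require Import perm ring lra.
Set Implicit Arguments.
Unset Strict Implicit.
Unset Printing Implicit Defensive.
Local Open Scope classical_set_scope.
Local Open Scope ring_scope.

(** Write [J (x, y)] for the matrix of [DH_x (y)] and [k = J (x, 0)^-1]. On its
domain [K_x] has derivative [J (x, K_x t)^-1], so the derivatives at 0 of the
non-jointly smooth [K] are expressed through [J] alone. This gives
[gamma_l = D_(- u, u) J k] with [u = k l], and, since the second derivative of
[phi_x (t, .)] vanishes at [t = 0], also [rho]. As mixed derivatives commute,
the antisymmetrization of [rho] is
[e_l gamma_l' - e_l' gamma_l + gamma_l gamma_l' - gamma_l' gamma_l - gamma_C],
which is the curvature of [nabla] by a direct computation of its commutator.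
For [DR], consistency says [Dpi_x (0) = gamma_x], so the generator at a
translation is [nabla_l] by the chain rule; in [Sigma] the second derivatives
of [pi_x] cancel and the same curvature expression is left. *)

(** * Symmetry of second derivatives *)

Section Schwarz.
Context {R : realType} {V : normedModType R}.
Implicit Types (x u v w : V).

Lemma differentiable_approx (W : normedModType R) (f : V -> W) x :
  differentiable f x -> forall e, 0 < e ->
  exists2 d, 0 < d & forall w, `|w| < d ->
    `|f (w + x) - f x - 'd f x w| <= e * `|w|.
Proof.
move=> /diff_locally /eqaddoP dfx e e0.
have /nbhs_ballP[d d0 dP] := dfx _ e0.
exists d => // w wd.
have := dP w; rewrite -ball_normE /= sub0r normrN => /(_ wd) /=.
by rewrite !fctE /= opprD addrA.
Qed.

(** The second difference over the parallelogram is [G h - G 0], where [G s] is the increment of [f]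
    along [h *: v] from [s *: u + x]. The mean value theorem turns it into [h] times an increment of
    ['D_u f], both ends of which are linearized at [x]. *)
Lemma second_difference_approx (f : V -> R) x u v :
  (\forall y \near x, differentiable f y) ->
  differentiable ('D_u f) x ->
  forall e, 0 < e -> exists2 d, 0 < d & forall h, 0 < h < d ->
    `|f (h *: v + (h *: u + x)) - f (h *: u + x) - f (h *: v + x) + f x
      - h ^+ 2 * 'D_v ('D_u f) x| <= e * h ^+ 2.
Proof.
move=> /nbhs_ballP[d1 /= d10 fd] dfu e e0.
(* The two linearization errors add up to at most [e / c * h] times twice the norm of [u] plus the
   norm of [v]; the added 1 keeps [c] positive. *)
pose c := `|u| + `|u| + `|v| + 1.
have c0 : 0 < c by rewrite ltr_wpDl// !addr_ge0.
have [d2 d20 dfuP] := differentiable_approx dfu (divr_gt0 e0 c0).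
pose d := Num.min d1 d2 / c.
have m0 : 0 < Num.min d1 d2 by rewrite lt_min d10.
exists d; first by rewrite divr_gt0.
move=> h /andP[h0 hd].
have hc : h * c < Num.min d1 d2 by rewrite -ltr_pdivlMr.
have small (s t : R) : 0 <= s <= h -> 0 <= t <= h ->
    `|t *: v + s *: u| < Num.min d1 d2.
  move=> /andP[s0 sh] /andP[t0 th]; apply: le_lt_trans hc.
  rewrite (le_trans (ler_normD _ _))// !normrZ !ger0_norm//.
  rewrite /c mulrDr mulr1 !mulrDr.
  have := ler_wpM2r (normr_ge0 v) th; have := ler_wpM2r (normr_ge0 u) sh.
  have := mulr_ge0 (ltW h0) (normr_ge0 u).
  by lra.
have dif (s t : R) : 0 <= s <= h -> 0 <= t <= h ->
    differentiable f (t *: v + (s *: u + x)).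
  move=> sh th; apply: fd; rewrite -ball_normE /= addrA opprD addrCA subrr addr0.
  by rewrite normrN; have := small s t sh th; rewrite lt_min => /andP[].
pose g (t s : R) := f (t *: v + (s *: u + x)).
have dg (s t : R) : 0 <= s <= h -> 0 <= t <= h ->
    is_derive s 1 (g t) ('D_u f (t *: v + (s *: u + x))).
  move=> sh th.
  have rate : (fun r : R => r^-1 *: ((g t \o shift s) (r *: 1) - g t s)) =
      (fun r => r^-1 *: ((f \o shift (t *: v + (s *: u + x))) (r *: u)
                        - f (t *: v + (s *: u + x)))).
    apply/funext => r /=; rewrite /g; congr (_ *: (f _ - _)).
    by rewrite [r%:A]mulr1 scalerDl -!addrA (addrCA (t *: v)).
  have := @diff_derivable _ _ _ f _ u (dif s t sh th); rewrite /derivable -rate => dfs.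
  by split=> //; rewrite /derive rate.
pose G := g h - g 0.
have h0h : 0 <= h <= h by rewrite lexx ltW.
have z0h : 0 <= (0 : R) <= h by apply/andP; split=> //; exact: ltW.
pose dG (s : R) := 'D_u f (h *: v + (s *: u + x)) - 'D_u f (0 *: v + (s *: u + x)).
have GdG (s : R) : 0 <= s <= h -> is_derive s 1 G (dG s).
  by move=> sh; apply: is_deriveB; apply: dg.
have [||s sh] := @MVT R G dG 0 h h0.
- by move=> s; rewrite in_itv/= => /andP[s0 sh]; apply: GdG; rewrite !ltW.
- apply: derivable_within_continuous => s; rewrite in_itv/= => sh.
  by have [] := GdG s sh.
have /andP[s0 s1] : 0 < s < h by move: sh; rewrite in_itv.
have sh' : 0 <= s <= h by rewrite !ltW.
rewrite subr0 /dG /G !fctE /g !scale0r !add0r => GE.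
have -> : f (h *: v + (h *: u + x)) - f (h *: u + x) - f (h *: v + x) + f x =
  f (h *: v + (h *: u + x)) - f (h *: u + x) - (f (h *: v + x) - f x).
  by ring.
rewrite GE.
have := small _ _ sh' z0h; have := small _ _ sh' h0h.
rewrite !lt_min => /andP[_ /dfuP e1] /andP[_ /dfuP e2].
have dE (a b : R) : 'd ('D_u f) x (a *: v + b *: u) =
    a * 'd ('D_u f) x v + b * 'd ('D_u f) x u by rewrite linearD !linearZ.
move: e2 e1; rewrite !dE scale0r mul0r !add0r -!addrA [in 'D_v _ _]deriveE//.
set A := 'D_u f (h *: v + _); set B := 'D_u f (s *: u + x); set C := 'D_u f x.
set P := 'd _ _ u; set Q := 'd _ _ v.
move=> e2 e1.
(* The common terms [C] and [s * P] of the two linearizations cancel, and only the mixed term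
   [h * Q] survives. *)
have -> : (A - B) * h - h ^+ 2 * Q =
    h * ((A - (C + (h * Q + s * P))) - (B - (C + s * P))).
  by rewrite expr2; ring.
rewrite normrM gtr0_norm// expr2 mulrCA ler_pM2l//.
have n1 : `|h *: v + s *: u| <= h * `|v| + h * `|u|.
  rewrite (le_trans (ler_normD _ _))// !normrZ !gtr0_norm// lerD2l.
  by rewrite ler_wpM2r// ltW.
have n2 : `|s *: u| <= h * `|u|.
  by rewrite normrZ gtr0_norm// ler_wpM2r// ltW.
have ec0 : 0 <= e / c by rewrite ltW// divr_gt0.
have := ler_wpM2l ec0 n1; have := ler_wpM2l ec0 n2.
have e1' : `|A - (C + (h * Q + s * P))| <= e / c * `|h *: v + s *: u|.
  by rewrite opprD.
have e2' : `|B - (C + s * P)| <= e / c * `|s *: u|.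
  by rewrite opprD.
have -> : e * h = e / c * (h * (`|u| + `|u| + `|v| + 1)).
  by rewrite -/c mulrCA divfK ?gt_eqF// mulrC.
have := mulr_ge0 ec0 (ltW h0).
rewrite !mulrDr mulr1.
have := ler_normB (A - (C + (h * Q + s * P))) (B - (C + s * P)).
by lra.
Qed.

(** The second difference is symmetric in [u] and [v], so for small [h] both mixed derivatives,
    times [h ^+ 2], lie within [e / 2 * h ^+ 2] of the same number. *)
Lemma derive_symmetry_real (f : V -> R) x u v :
  (\forall y \near x, differentiable f y) ->
  differentiable ('D_u f) x -> differentiable ('D_v f) x ->
  'D_v ('D_u f) x = 'D_u ('D_v f) x.
Proof.
move=> df du dv; apply/eqP; rewrite -subr_eq0 -normr_le0.
apply/ler_addgt0Pl => e e0; rewrite addr0.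
have e20 : 0 < e / 2 by rewrite divr_gt0.
have [d1 d10 P1] := second_difference_approx v df du e20.
have [d2 d20 P2] := second_difference_approx u df dv e20.
have m0 : 0 < Num.min d1 d2 by rewrite lt_min d10.
pose h := Num.min d1 d2 / 2.
have h0 : 0 < h by rewrite divr_gt0.
have : h < Num.min d1 d2 by rewrite /h ltr_pdivrMr// ltr_pMr// ltr1n.
rewrite lt_min => /andP[hd1 hd2].
have := P1 h; rewrite h0 hd1 => /(_ isT).
have := P2 h; rewrite h0 hd2 => /(_ isT).
rewrite addrCA; set A := f _; set B := f _; set C := f _; set D := f _.
set a := 'D_u _ _; set b := 'D_v _ _ => H2 H1.
have h20 : 0 < h ^+ 2 by rewrite exprn_gt0.
rewrite -(ler_pM2r h20) -[X in _ * X <= _](gtr0_norm h20) -normrM.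
rewrite [X in `|X|](_ : _ = (A - B - C + D - h ^+ 2 * a)
                          - (A - C - B + D - h ^+ 2 * b)); last by ring.
move: H2 H1; set X := (_ - h ^+ 2 * a); set Y := (_ - h ^+ 2 * b) => HX HY.
have -> : e * h ^+ 2 = e / 2 * h ^+ 2 + e / 2 * h ^+ 2 by rewrite -mulrDl -splitr.
exact: le_trans (ler_normB X Y) (lerD HX HY).
Qed.

End Schwarz.

(** * Differential calculus of matrix-valued maps *)

Section HasDerive.
Context {R : realType}.
Implicit Types U V W : normedModType R.

(** The first-order expansion of [f] at [x] is also one of [g], and an expansion with a continuous
    linear part determines the differential. *)
Lemma near_eq_differentiable V W (f g : V -> W) x :
  (\forall y \near x, f y = g y) -> differentiable f x -> differentiable g x.
Proof.
move=> fg df; have fgx := nbhs_singleton fg.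
have dg : g \o shift x = cst (g x) + 'd f x +o_ 0 id.
  apply/eqaddoP => e e0; have /diff_locally/eqaddoP/(_ e e0) := df.
  move: fg; rewrite (near_shift 0) subr0.
  by apply: filterS2 => h /= fgh; rewrite !fctE /= fgh fgx.
have dfc := diff_continuous df.
by apply/diff_locallyP; rewrite (diff_unique dfc dg).
Qed.

(** Pairs differentiability with one directional value: the chain rule needs the former at every
    stage, while the computations track only the latter. *)
Definition has_derive V W (x v : V) (f : V -> W) (d : W) : Prop :=
  differentiable f x /\ 'D_v f x = d.

Lemma has_deriveP V W (x v : V) (f : V -> W) :
  differentiable f x -> has_derive x v f ('D_v f x).
Proof. by []. Qed.

Lemma has_derive_eq V W (x v : V) (f : V -> W) (d d' : W) :
  has_derive x v f d -> d = d' -> has_derive x v f d'.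
Proof. by move=> ? <-. Qed.

Lemma has_derive_near V W (x v : V) (f g : V -> W) (d : W) :
  (\forall y \near x, f y = g y) -> has_derive x v f d -> has_derive x v g d.
Proof.
move=> fg [df <-]; split; first exact: near_eq_differentiable df.
by apply: near_eq_derive; apply: filterS fg => y ->.
Qed.

Lemma has_derive_cst V W (x v : V) (c : W) : has_derive x v (fun=> c) 0.
Proof. by split; [exact: differentiable_cst | exact: derive_cst]. Qed.

Lemma has_derive_id V (x v : V) : has_derive x v id v.
Proof. by split; [exact: ex_diff | exact: derive_id]. Qed.

Lemma has_deriveD V W (x v : V) (f g : V -> W) a b :
  has_derive x v f a -> has_derive x v g b ->
  has_derive x v (fun y => f y + g y) (a + b).
Proof.
move=> [df <-] [dg <-]; split; first exact: differentiableD.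
by apply: deriveD; exact: diff_derivable.
Qed.

Lemma has_derive_shift V W (x v : V) (f : V -> W) a (c : W) :
  has_derive x v f a -> has_derive x v (fun y => c + f y) a.
Proof.
move=> fa; apply: has_derive_eq (has_deriveD (has_derive_cst x v c) fa) _.
exact: add0r.
Qed.

Lemma has_deriveN V W (x v : V) (f : V -> W) a :
  has_derive x v f a -> has_derive x v (fun y => - f y) (- a).
Proof.
move=> [df <-]; split; first exact: differentiableN.
by apply: deriveN; exact: diff_derivable.
Qed.

Lemma has_deriveB V W (x v : V) (f g : V -> W) a b :
  has_derive x v f a -> has_derive x v g b ->
  has_derive x v (fun y => f y - g y) (a - b).
Proof. by move=> fa gb; apply: has_deriveD => //; exact: has_deriveN. Qed.

Lemma has_derive_sum V W (x v : V) (I : Type) (r : seq I) (F : I -> V -> W) a :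
  (forall i, has_derive x v (F i) (a i)) ->
  has_derive x v (fun y => \sum_(i <- r) F i y) (\sum_(i <- r) a i).
Proof.
move=> Fa; elim: r => [|i r IH].
  rewrite big_nil; under eq_fun do rewrite big_nil.
  exact: has_derive_cst.
rewrite big_cons; under eq_fun do rewrite big_cons.
exact: has_deriveD.
Qed.

Lemma has_deriveM V (x v : V) (f g : V -> R) a b :
  has_derive x v f a -> has_derive x v g b ->
  has_derive x v (fun y => f y * g y) (a * g x + f x * b).
Proof.
move=> [df <-] [dg <-]; split; first exact: differentiableM.
rewrite [LHS]deriveM; try exact: diff_derivable.
by rewrite addrC mulrC.
Qed.

Lemma has_derive_comp U V W (x v : U) (f : U -> V) (g : V -> W) a b :
  has_derive x v f a -> has_derive (f x) a g b ->
  has_derive x v (fun y => g (f y)) b.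
Proof.
move=> [df <-] [dg <-]; have dgf := differentiable_comp df dg.
split; first exact: dgf.
by rewrite deriveE// [LHS](congr1 (fun h => h v) (diff_comp df dg))/= !deriveE.
Qed.

Lemma has_derive_pair U V W (x v : U) (f : U -> V) (g : U -> W) a b :
  has_derive x v f a -> has_derive x v g b ->
  has_derive x v (fun y => (f y, g y)) (a, b).
Proof.
move=> [df <-] [dg <-]; split; first exact: differentiable_pair.
rewrite deriveE; last exact: differentiable_pair.
by rewrite diff_pair// !deriveE.
Qed.

Lemma has_derive_linear V W (L : {linear V -> W}) (x v : V) :
  continuous L -> has_derive x v L (L v).
Proof.
move=> Lc; split; first exact: linear_differentiable.
by rewrite deriveE ?diff_lin//; exact: linear_differentiable.
Qed.

(** * Matrix-valued maps: entries, products, determinants *)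

Section Matrix.
Context {V : normedModType R}.
Implicit Types x v : V.

Lemma differentiable_mxP m n (M : V -> 'M[R]_(m, n)) x :
  differentiable M x <-> forall i j, differentiable (fun y => M y i j) x.
Proof.
split=> [dM i j|dM].
  exact: (differentiable_comp dM (differentiable_coord (M x) i j)).
have -> : M = fun y => \sum_(i < m) \sum_(j < n) M y i j *: delta_mx i j.
  by apply/funext => y; exact: matrix_sum_delta.
have dE i j := differentiableZl (delta_mx i j : 'M[R]_(m, n)) (dM i j).
(* The direction 0 is a dummy: only the differentiability half of the result is kept. *)
have dS i := has_derive_sum (index_enum 'I_n) (fun j => has_deriveP 0 (dE i j)).
exact: (has_derive_sum (index_enum 'I_m) dS).1.
Qed.

Lemma derive_mxE m n (M : V -> 'M[R]_(m, n)) x v i j :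
  differentiable M x -> ('D_v M x) i j = 'D_v (fun y => M y i j) x.
Proof. by move=> /(@diff_derivable _ _ _ _ _ v)/derive_mx ->; rewrite mxE. Qed.

Lemma has_derive_mxP m n (M : V -> 'M[R]_(m, n)) x v d :
  has_derive x v M d <-> forall i j, has_derive x v (fun y => M y i j) (d i j).
Proof.
split=> [[dM <-] i j|dM].
  by rewrite derive_mxE//; split=> //; move/differentiable_mxP : dM.
have dMx : differentiable M x by apply/differentiable_mxP => i j; have [] := dM i j.
by split=> //; apply/matrixP => i j; rewrite derive_mxE//; have [] := dM i j.
Qed.

Lemma has_derive_mulmx m n p (A : V -> 'M[R]_(m, n)) (B : V -> 'M[R]_(n, p))
    x v a b :
  has_derive x v A a -> has_derive x v B b ->
  has_derive x v (fun y => A y *m B y) (a *m B x + A x *m b).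
Proof.
move=> /has_derive_mxP Aa /has_derive_mxP Bb; apply/has_derive_mxP => i j.
rewrite !mxE -big_split/=; under eq_fun do rewrite mxE.
by apply: has_derive_sum => k; exact: has_deriveM.
Qed.

Lemma has_derive_mulmxr m n p (A : V -> 'M[R]_(m, n)) (c : 'M[R]_(n, p)) x v a :
  has_derive x v A a -> has_derive x v (fun y => A y *m c) (a *m c).
Proof.
move=> Aa; apply: has_derive_eq (has_derive_mulmx Aa (has_derive_cst x v c)) _.
by rewrite mulmx0 addr0.
Qed.

Lemma has_deriveZ m n (k : V -> R) (A : V -> 'M[R]_(m, n)) x v c a :
  has_derive x v k c -> has_derive x v A a ->
  has_derive x v (fun y => k y *: A y) (c *: A x + k x *: a).
Proof.
move=> kc /has_derive_mxP Aa; apply/has_derive_mxP => i j.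
by rewrite !mxE; under eq_fun do rewrite mxE; exact: has_deriveM.
Qed.

Lemma differentiable_prod (I : Type) (r : seq I) (F : I -> V -> R) x :
  (forall i, differentiable (F i) x) ->
  differentiable (fun y => \prod_(i <- r) F i y) x.
Proof.
move=> dF; elim: r => [|i r IH].
  by under eq_fun do rewrite big_nil; exact: differentiable_cst.
by under eq_fun do rewrite big_cons; exact: differentiableM.
Qed.

Lemma differentiable_det n (A : V -> 'M[R]_n) x :
  differentiable A x -> differentiable (fun y => \det (A y)) x.
Proof.
move=> /differentiable_mxP dA; rewrite /determinant.
have dP (s : 'S_n) :
    differentiable (fun y => (-1) ^+ s * \prod_i A y i (s i)) x.
  by apply: differentiableM => //; exact: differentiable_prod.
by have [] := has_derive_sum (index_enum 'S_n) (fun s => has_deriveP 0 (dP s)).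
Qed.

End Matrix.

(** * Inverse matrices and mixed derivatives of matrix-valued maps *)

Section InverseMatrix.
Context {V : normedModType R}.
Implicit Types x v : V.

Lemma near_unitmx n (A : V -> 'M[R]_n) x :
  {for x, continuous A} -> A x \in unitmx -> \forall y \near x, A y \in unitmx.
Proof.
move=> cA; rewrite unitmxE unitfE => Ax0.
have cdet : {for x, continuous (fun y => \det (A y))}.
  have ddet := @differentiable_det _ n id (A x) (has_derive_id (A x) 0).1.
  apply: (@continuous_comp _ _ _ A (fun M => \det M)) => //.
  exact: differentiable_continuous.
have nz : \forall y \near x, \det (A y) != 0 by apply: cvgr_neq0 cdet Ax0.
by apply: filterS nz => y Ay0; rewrite unitmxE unitfE.
Qed.

Lemma differentiable_invmx n (A : V -> 'M[R]_n) x :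
  differentiable A x -> A x \in unitmx -> differentiable (fun y => invmx (A y)) x.
Proof.
move=> dA Au; have := near_unitmx (differentiable_continuous dA) Au.
(* [invmx] returns a singular argument unchanged, so the cofactor formula, rational in the entries,
   is used only near [x], where [A] stays invertible. *)
move=> nu; apply: (@near_eq_differentiable _ _
  (fun y => (\det (A y))^-1 *: \adj (A y))).
  by apply: filterS nu => y Ayu; rewrite /invmx Ayu.
apply/differentiable_mxP => i j.
under eq_fun do rewrite 2!mxE.
apply: differentiableM.
  by apply: differentiableV; [exact: differentiable_det | rewrite -unitfE -unitmxE].
apply: differentiableM => //; apply: differentiable_det.
apply/differentiable_mxP => k l; under eq_fun do rewrite 2!mxE.
by move/differentiable_mxP : dA.
Qed.

(** Differentiate [A y *m invmx (A y) = 1%:M], valid near [x], and solve for the derivative of the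
    inverse. *)
Lemma has_derive_invmx n (A : V -> 'M[R]_n) x v a :
  has_derive x v A a -> A x \in unitmx ->
  has_derive x v (fun y => invmx (A y)) (- (invmx (A x) *m a *m invmx (A x))).
Proof.
move=> Aa Au; have nu := near_unitmx (differentiable_continuous Aa.1) Au.
have dI := has_deriveP v (differentiable_invmx Aa.1 Au).
have [_ dAI] := has_derive_mulmx Aa dI.
have [_ d1] : has_derive x v (fun y => A y *m invmx (A y)) 0.
  apply: has_derive_near (has_derive_cst x v 1%:M).
  by apply: filterS nu => y yu; rewrite mulmxV.
apply: has_derive_eq dI _; move: dAI; set d := 'D_v (fun y => invmx _) x => dAI.
have Ad : A x *m d = - (a *m invmx (A x)).
  by apply/eqP; rewrite -addr_eq0 addrC -dAI d1.
by rewrite -[LHS](mulKmx Au) Ad mulmxN mulmxA.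
Qed.

Lemma derive_symmetry m n (A : V -> 'M[R]_(m, n)) x u v :
  (\forall y \near x, differentiable A y) ->
  differentiable ('D_u A) x -> differentiable ('D_v A) x ->
  'D_v ('D_u A) x = 'D_u ('D_v A) x.
Proof.
move=> dA du dv; apply/matrixP => i j.
apply: etrans (derive_mxE v i j du) _; apply: etrans _ (esym (derive_mxE u i j dv)).
have E w : \forall y \near x, ('D_w A y) i j = 'D_w (fun y => A y i j) y.
  by apply: filterS dA => y dAy; rewrite derive_mxE.
apply: etrans (near_eq_derive v (E u)) _.
apply: etrans _ (esym (near_eq_derive u (E v))).
apply: derive_symmetry_real.
- by apply: filterS dA => y /differentiable_mxP.
- by apply: near_eq_differentiable (E u) _; move/differentiable_mxP : du.
- by apply: near_eq_differentiable (E v) _; move/differentiable_mxP : dv.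
Qed.

End InverseMatrix.
End HasDerive.

(** Both difference quotients are the same function of the increment. Partial derivatives thus
    become derivatives of a jointly smooth map. *)
Lemma derive_partial2 (R : realType) (E1 E2 W : normedModType R)
    (f : E1 -> E2 -> W) x y v :
  'D_v (f x) y = 'D_(0, v) (fun p : E1 * E2 => f p.1 p.2) (x, y).
Proof.
rewrite /derive; set g := (fun h : R => _); set g' := (fun h : R => _).
by suff -> : g = g' by []; apply/funext => h; rewrite /g /g' /= scaler0 add0r.
Qed.

Local Opaque derive diff invmx.

Lemma has_derive_fst (R : realType) (V W : normedModType R) (p v : V * W) :
  has_derive p v fst v.1.
Proof.
exact: (@has_derive_linear _ _ _ (fst : {linear (V * W)%type -> V}) p v
  (fun q => @cvg_fst _ _ _ _ _)).
Qed.

Lemma has_derive_snd (R : realType) (V W : normedModType R) (p v : V * W) :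
  has_derive p v snd v.2.
Proof.
exact: (@has_derive_linear _ _ _ (snd : {linear (V * W)%type -> W}) p v
  (fun q => @cvg_snd _ _ _ _ _)).
Qed.

Lemma has_derive_mulmxl (R : realType) (V : normedModType R) m n p
    (c : 'M[R]_(m, n)) (A : V -> 'M[R]_(n, p)) x v a :
  has_derive x v A a -> has_derive x v (fun y => c *m A y) (c *m a).
Proof.
move=> Aa; apply: has_derive_eq (has_derive_mulmx (has_derive_cst x v c) Aa) _.
by rewrite mul0mx add0r.
Qed.

Lemma mulmx_cV_inj (R : comNzRingType) m n (A B : 'M[R]_(m, n)) :
  (forall v : 'cV_n, A *m v = B *m v) -> A = B.
Proof.
move=> AB; apply/matrixP => i j; have /colP/(_ i) := AB (delta_mx j ord0).
by rewrite -!colE !mxE.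
Qed.

(** * Dependence of derivatives on the direction *)

Section Directions.
Context {R : realType}.
Implicit Types U V W : normedModType R.

Lemma derive_dirD V W (f : V -> W) x u v :
  differentiable f x -> 'D_(u + v) f x = 'D_u f x + 'D_v f x.
Proof. by move=> df; rewrite !deriveE// linearD. Qed.

Lemma derive_dirN V W (f : V -> W) x u :
  differentiable f x -> 'D_(- u) f x = - 'D_u f x.
Proof. by move=> df; rewrite !deriveE// linearN. Qed.

Lemma derive_dir_sum V W (f : V -> W) x m (c : 'I_m -> R) (w : 'I_m -> V) :
  differentiable f x ->
  'D_(\sum_j c j *: w j) f x = \sum_j c j *: 'D_(w j) f x.
Proof.
move=> df; rewrite deriveE// linear_sum; apply: eq_bigr => j _.
by rewrite linearZ deriveE.
Qed.

Lemma col_sum_delta m (v : 'cV[R]_m) : v = \sum_j v j ord0 *: delta_mx j ord0.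
Proof.
rewrite {1}(matrix_sum_delta v); apply: eq_bigr => j _.
by rewrite (big_ord1 _ (fun k => v j k *: delta_mx j k)).
Qed.

Section VariableDirection.
Context {U V : normedModType R} {m p q : nat}.
Variables (L : 'cV[R]_m -> V) (G : V -> 'M[R]_(p, q)).
Hypothesis linL : linear L.

Lemma derive_linear_dir z (c : 'cV[R]_m) : differentiable G z ->
  'D_(L c) G z = \sum_j c j ord0 *: 'D_(L (delta_mx j ord0)) G z.
Proof.
pose Ll : {linear 'cV[R]_m -> V} := HB.pack L (GRing.isLinear.Build _ _ _ _ _ linL).
move=> dG; have -> : L c = \sum_j c j ord0 *: L (delta_mx j ord0).
  rewrite -[L]/(Ll : _ -> _) {1}(col_sum_delta c) linear_sum.
  by apply: eq_bigr => j _; rewrite linearZ.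
exact: derive_dir_sum.
Qed.

(** In the coordinates of [u y] the derivative is a finite sum of scalars times derivatives along
    fixed directions, so the product rule applies: one term moves the point with the direction
    frozen, the other varies the direction. [L] embeds the coordinates in [V], for instance as
    vertical vectors [(0, v)]. *)
Lemma has_derive_dir (g : U -> V) (u : U -> 'cV[R]_m) x a dg du :
  (\forall z \near g x, differentiable G z) ->
  (forall v, differentiable ('D_v G) (g x)) ->
  has_derive x a g dg -> has_derive x a u du ->
  has_derive x a (fun y => 'D_(L (u y)) G (g y))
    ('D_dg ('D_(L (u x)) G) (g x) + 'D_(L du) G (g x)).
Proof.
move=> dG d2G gdg /has_derive_mxP udu.
have near_g : \forall y \near x, differentiable G (g y).
  have cg : g @ x --> g x := differentiable_continuous gdg.1.
  exact: cg dG.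
pose e j : 'cV[R]_m := delta_mx j ord0.
have dD j : has_derive x a (fun y => 'D_(L (e j)) G (g y)) ('D_dg ('D_(L (e j)) G) (g x)).
  exact: (has_derive_comp gdg (has_deriveP dg (d2G (L (e j))))).
have Hs := has_derive_sum (index_enum 'I_m)
  (fun j => has_deriveZ (udu j ord0) (dD j)).
apply: (has_derive_near _ (has_derive_eq Hs _)).
  by apply: filterS near_g => y dGy; rewrite derive_linear_dir.
rewrite big_split/= addrC derive_linear_dir; last exact: nbhs_singleton dG.
congr (_ + _).
have Hc := has_derive_sum (index_enum 'I_m)
  (fun j => has_deriveZ (has_derive_cst (g x) dg (u x j ord0))
                        (has_deriveP dg (d2G (L (e j))))).
have [_ DE] : has_derive (g x) dg ('D_(L (u x)) G)
    (\sum_j (0 *: 'D_(L (e j)) G (g x) + u x j ord0 *: 'D_dg ('D_(L (e j)) G) (g x))).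
  apply: has_derive_near Hc.
  by apply: filterS dG => z dGz; rewrite derive_linear_dir.
by rewrite DE; apply: eq_bigr => j _; rewrite scale0r add0r.
Qed.

End VariableDirection.

Section SecondOrder.
Context {V W : normedModType R}.
Variables (G : V -> W) (x : V).
Hypothesis dG : \forall z \near x, differentiable G z.
Hypothesis d2G : forall v, differentiable ('D_v G) x.

Lemma derive2_dirD w a b :
  'D_w ('D_(a + b) G) x = 'D_w ('D_a G) x + 'D_w ('D_b G) x.
Proof.
have [_ <-] := has_deriveD (has_deriveP w (d2G a)) (has_deriveP w (d2G b)).
by apply: near_eq_derive; apply: filterS dG => z dGz; rewrite derive_dirD.
Qed.

Lemma derive2_dirN w a : 'D_w ('D_(- a) G) x = - 'D_w ('D_a G) x.
Proof.
have [_ <-] := has_deriveN (has_deriveP w (d2G a)).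
by apply: near_eq_derive; apply: filterS dG => z dGz; rewrite derive_dirN.
Qed.

End SecondOrder.

Lemma smooth_differentiable V W (U : set V) (f : V -> W) x :
  smooth U f -> U x -> differentiable f x.
Proof. by move=> /(_ 1%N)[df _]; exact: df. Qed.

Lemma smooth_derive V W (U : set V) (f : V -> W) v :
  smooth U f -> smooth U ('D_v f).
Proof. by move=> sf k; have [_] := sf k.+1; exact. Qed.

End Directions.

(** * Connection, anholonomy and curvature of a deformation *)

(** [K] stands for [k_x]; [P] and [Q] are the vertical and horizontal derivatives of [Hjac] along
    [k l], the primed ones those along [k l']. [S1] and [S2] are pure second derivatives, [S3] mixed
    ones, and [W], [W'] come from differentiating [k] inside a direction. *)
Lemma curvature_algebra (R : comPzRingType) n
    (K P P' Q Q' S1 S1' S2 S2' S3 S3' W W' : 'M[R]_n) (th : 'cV[R]_n) :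
  S1 = S1' -> S2 = S2' ->
  (S1 - (P' - Q') *m K *m P - S3) *m (K *m th)
  - (S1' - (P - Q) *m K *m P' - S3') *m (K *m th) =
  ((S3' - S2' + W) *m K + (P' - Q') *m - (K *m Q *m K)
   - ((S3 - S2 + W') *m K + (P - Q) *m - (K *m Q' *m K))
   + (P - Q) *m K *m ((P' - Q') *m K) - (P' - Q') *m K *m ((P - Q) *m K)
   - (W - W') *m K) *m th.
Proof.
move=> -> ->; rewrite -mulmxBl [LHS]mulmxA; congr (_ *m _).
rewrite !(mulmxBl, mulmxDl, mulmxN, mulNmx, mulmxBr, mulmxA).
move: (S1' *m K) (S2' *m K) (S3 *m K) (S3' *m K) (W *m K) (W' *m K).
move=> {}S1 {}S2 {}S3 {}S3' {}W {}W'.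
move: (P *m K *m P' *m K) (P' *m K *m P *m K) => a1 a2.
move: (P *m K *m Q' *m K) (P' *m K *m Q *m K) => a3 a4.
move: (Q *m K *m P' *m K) (Q' *m K *m P *m K) => a5 a6.
move: (Q *m K *m Q' *m K) (Q' *m K *m Q *m K) => a7 a8.
by apply/matrixP => i j; rewrite !mxE; ring.
Qed.

(** [gC] stands for the matrix of [gamma] along the anholonomy object: it enters the covariant
    derivative and the curvature with opposite signs. *)
Lemma nabla_algebra (R : comPzRingType) n (s s' w w' t t' th : 'cV[R]_n)
    (d d' g g' gC : 'M[R]_n) : s' = s ->
  (s + w + (d' *m th + g' *m t)) + g *m (t' + g' *m th)
  - ((s' + w' + (d *m th + g *m t')) + g' *m (t + g *m th)) =
  (w - w' + gC *m th) + (d' - d + g *m g' - g' *m g - gC) *m th.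
Proof.
move=> ->; rewrite !mulmxDr !(mulmxBl, mulmxDl) !mulmxA.
move: (d *m th) (d' *m th) (g *m t') (g' *m t) => a1 a2 a3 a4.
move: (g *m g' *m th) (g' *m g *m th) (gC *m th) => a5 a6 a7.
by apply/matrixP => i j; rewrite !mxE; ring.
Qed.

(** * The Jacobian of a deformation and the derivatives of its inverse *)

Section Deformations.
Context {R : realType} {n : nat} {X : set 'cV[R]_n} (D : deformation X).
Hypothesis oX : open X.
Local Notation E := 'cV[R]_n.
Implicit Types (x y u v l t : E) (p : E * E).

Let F p := Hmap D p.1 p.2.

(** The Jacobian of [Hmap D p.1] at [p.2], taken as vertical derivatives of the joint map so that it
    can also be differentiated along the base point. *)
Definition Hjac p : 'M[R]_n :=
  \matrix_(i, j) ('D_(0, delta_mx j ord0) F p) i ord0.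

Lemma linear_pair0l : linear ((fun v => (0, v)) : E -> (E * E)%type).
Proof. by move=> a u v; congr pair; rewrite /= scaler0 addr0. Qed.

(** This is the direction in [gamma_mx]: base point and displacement move oppositely, so that their
    sum stays fixed. Linearity is what [has_derive_dir] asks for. *)
Lemma linear_pairN : linear ((fun v => (- v, v)) : E -> (E * E)%type).
Proof. by move=> a u v; congr pair; rewrite /= opprD scalerN. Qed.

Lemma near_domH p : domH D p -> \forall q \near p, domH D q.
Proof. by move=> Dp; apply: open_nbhs_nbhs; split=> //; exact: domH_open. Qed.

Lemma near_X x : X x -> \forall y \near x, X y.
Proof. by move=> Xx; apply: open_nbhs_nbhs; split. Qed.

Lemma domH0 x : X x -> domH D (x, 0).
Proof. exact: domH_zero. Qed.

Let smoothF : smooth (domH D) F := @Hmap_smooth _ _ _ D.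

Lemma HjacE p v : domH D p -> Hjac p *m v = 'D_(0, v) F p.
Proof.
move=> Dp; rewrite (derive_linear_dir linear_pair0l v (smooth_differentiable smoothF Dp)).
apply/colP => i; rewrite mxE summxE; apply: eq_bigr => j _.
by rewrite !mxE mulrC.
Qed.

Lemma differentiable_Hjac p : domH D p -> differentiable Hjac p.
Proof.
move=> Dp; apply/differentiable_mxP => i j; under eq_fun do rewrite mxE.
have /differentiable_mxP := smooth_differentiable
  (smooth_derive (0, delta_mx j ord0) smoothF) Dp; exact.
Qed.

Lemma derive_HjacE p w v : domH D p ->
  'D_w Hjac p *m v = 'D_w ('D_(0, v) F) p.
Proof.
move=> Dp.
have [_ dH] := has_derive_mulmxr v (has_deriveP w (differentiable_Hjac Dp)).
rewrite -dH; apply: near_eq_derive.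
by apply: filterS (near_domH Dp) => q Dq; rewrite HjacE.
Qed.

Lemma differentiable_derive_Hjac p w : domH D p -> differentiable ('D_w Hjac) p.
Proof.
move=> Dp; apply/differentiable_mxP => i j.
have /differentiable_mxP dF := smooth_differentiable
  (smooth_derive w (smooth_derive (0, delta_mx j ord0) smoothF)) Dp.
apply: near_eq_differentiable (dF i ord0).
apply: filterS (near_domH Dp) => q Dq; rewrite -derive_HjacE// mxE.
rewrite (bigD1 j)//= big1 ?addr0 ?mxE ?eqxx ?mulr1// => k kj.
by rewrite mxE (negbTE kj) mulr0.
Qed.

Lemma near_differentiable_Hjac p : domH D p ->
  \forall q \near p, differentiable Hjac q.
Proof.
by move=> Dp; apply: filterS (near_domH Dp) => q; exact: differentiable_Hjac.
Qed.

Lemma derive2_Hjac_sym p (u v : E * E) : domH D p ->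
  'D_v ('D_u Hjac) p = 'D_u ('D_v Hjac) p.
Proof.
move=> Dp; apply: derive_symmetry; first exact: near_differentiable_Hjac.
  exact: differentiable_derive_Hjac.
exact: differentiable_derive_Hjac.
Qed.

(** Both sides are second derivatives of the joint map along two vertical directions, so this is the
    symmetry of the second derivative of [H_x]. *)
Lemma derive_Hjac_sym p u v : domH D p ->
  'D_(0, u) Hjac p *m v = 'D_(0, v) Hjac p *m u.
Proof.
move=> Dp; apply: etrans (derive_HjacE _ _ Dp) _.
apply: etrans _ (esym (derive_HjacE _ _ Dp)); apply: derive_symmetry.
- by apply: filterS (near_domH Dp) => q; exact: smooth_differentiable.
- exact: smooth_differentiable (smooth_derive _ smoothF) Dp.
- exact: smooth_differentiable (smooth_derive _ smoothF) Dp.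
Qed.

Lemma hmxE x : hmx D x = Hjac (x, 0).
Proof. by apply/matrixP => i j; rewrite !mxE derive_partial2. Qed.

Lemma Kmap0 x : X x -> Kmap D x 0 = 0.
Proof. by move=> Xx; rewrite -{1}(Hmap_zero D Xx) HmapK//; exact: domH0. Qed.

Lemma target0 x : X x -> target D x 0 = x.
Proof. by move=> Xx; rewrite /target Kmap0// addr0. Qed.

Lemma domK0 x : X x -> domK D x 0.
Proof. by move=> Xx; exists 0; [exact: domH0 | exact: Hmap_zero]. Qed.

Lemma near_domK x t : X x -> domK D x t -> \forall s \near t, domK D x s.
Proof.
by move=> Xx Dt; apply: open_nbhs_nbhs; split=> //; exact: Hmap_image_open.
Qed.

Lemma domH_Kmap x t : domK D x t -> domH D (x, Kmap D x t).
Proof. by case=> y Dy <-; rewrite HmapK. Qed.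

Lemma KmapK x t : domK D x t -> Hmap D x (Kmap D x t) = t.
Proof. by case=> y Dy <-; rewrite HmapK. Qed.

Lemma differentiable_Kmap x t : X x -> domK D x t -> differentiable (Kmap D x) t.
Proof. by move=> Xx Dt; exact: smooth_differentiable (Kmap_smooth D Xx) Dt. Qed.

(** Differentiates [Hmap D x (Kmap D x s) = s], which holds on the open set [domK D x]. *)
Lemma Hjac_derive_Kmap x t l : X x -> domK D x t ->
  Hjac (x, Kmap D x t) *m 'D_l (Kmap D x) t = l.
Proof.
move=> Xx Dt; have dK := has_deriveP l (differentiable_Kmap Xx Dt).
have DK := domH_Kmap Dt; rewrite HjacE//.
have [_ <-] := has_derive_comp (has_derive_pair (has_derive_cst t l x) dK)
  (has_deriveP _ (smooth_differentiable smoothF DK)).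
rewrite -[RHS](derive_id t l); apply: near_eq_derive.
by apply: filterS (near_domK Xx Dt) => s Ds; rewrite /F /= KmapK.
Qed.

(** The identity of [Hjac_derive_Kmap] on basis vectors supplies a right inverse, which suffices for
    a square matrix. *)
Lemma Hjac_unit x t : X x -> domK D x t -> Hjac (x, Kmap D x t) \in unitmx.
Proof.
move=> Xx Dt.
pose B : 'M[R]_n := \matrix_(i, j) ('D_(delta_mx j ord0) (Kmap D x) t) i ord0.
suff /mulmx1_unit[u _] : Hjac (x, Kmap D x t) *m B = 1%:M by exact: u.
apply/matrixP => i j.
have /colP/(_ i) := Hjac_derive_Kmap (delta_mx j ord0) Xx Dt.
rewrite !mxE andbT => <-; apply: eq_bigr => k _.
by rewrite !mxE.
Qed.

Lemma has_derive_Kmap x t l : X x -> domK D x t ->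
  has_derive t l (Kmap D x) (invmx (Hjac (x, Kmap D x t)) *m l).
Proof.
move=> Xx Dt; apply: has_derive_eq (has_deriveP l (differentiable_Kmap Xx Dt)) _.
by rewrite -{2}(Hjac_derive_Kmap l Xx Dt) mulKmx// Hjac_unit.
Qed.

Lemma hmx_unit x : X x -> hmx D x \in unitmx.
Proof.
by move=> Xx; have := Hjac_unit Xx (domK0 Xx); rewrite (Kmap0 Xx) hmxE.
Qed.

Lemma kmxE x : kmx D x = invmx (Hjac (x, 0)).
Proof. by rewrite /kmx hmxE. Qed.

Lemma derive_Kmap0 x l : X x -> 'D_l (Kmap D x) 0 = kmx D x *m l.
Proof.
by move=> Xx; rewrite (has_derive_Kmap l Xx (domK0 Xx)).2 (Kmap0 Xx) kmxE.
Qed.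

Lemma has_derive_Kmap0 x l : X x -> has_derive 0 l (Kmap D x) (kmx D x *m l).
Proof.
move=> Xx; apply: has_derive_eq (has_derive_Kmap l Xx (domK0 Xx)) _.
by rewrite (Kmap0 Xx) kmxE.
Qed.

Lemma has_derive_target0 x l : X x ->
  has_derive 0 l (target D x) (kmx D x *m l).
Proof.
by move=> Xx; exact: has_derive_shift (has_derive_Kmap0 l Xx).
Qed.

Lemma near0_domain x : X x ->
  \forall t \near (0 : E), domK D x t /\ X (target D x t).
Proof.
move=> Xx; apply: filterI; first exact: near_domK (domK0 Xx).
have ct : {for 0, continuous (target D x)} :=
  differentiable_continuous (has_derive_target0 0 Xx).1.
by apply: ct; rewrite target0//; exact: near_X.
Qed.

Lemma has_derive_Hjac0 x v : X x ->
  has_derive x v (fun y => Hjac (y, 0)) ('D_(v, 0) Hjac (x, 0)).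
Proof.
move=> Xx; apply: (has_derive_comp
  (has_derive_pair (has_derive_id x v) (has_derive_cst x v 0))).
by apply: has_deriveP; apply: differentiable_Hjac; exact: domH0.
Qed.

Lemma has_derive_kmx x v : X x ->
  has_derive x v (kmx D) (- (kmx D x *m 'D_(v, 0) Hjac (x, 0) *m kmx D x)).
Proof.
move=> Xx; have u := hmx_unit Xx; rewrite hmxE in u.
rewrite kmxE (_ : kmx D = fun y => invmx (Hjac (y, 0))); last first.
  by apply/funext => y; rewrite kmxE.
exact: has_derive_invmx (has_derive_Hjac0 v Xx) u.
Qed.

Lemma has_derive_kmx_target x l : X x -> has_derive 0 l (fun t => kmx D (target D x t))
  (- (kmx D x *m 'D_(kmx D x *m l, 0) Hjac (x, 0) *m kmx D x)).
Proof.
move=> Xx; have := has_derive_kmx (kmx D x *m l) Xx; rewrite -{1}(target0 Xx).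
exact: has_derive_comp (has_derive_target0 l Xx).
Qed.

(** * The connection matrices and the anholonomy object *)

Local Notation k := (kmx D).
Implicit Types a b : E.

Definition gamma_mx l y : 'M[R]_n := 'D_(- (k y *m l), k y *m l) Hjac (y, 0) *m k y.

Lemma has_derive_phi x t s b :
  X (target D x t) -> domK D (target D x t) s ->
  domH D (x, Kmap D x t + Kmap D (target D x t) s) ->
  has_derive s b (phi D x t)
    (Hjac (x, Kmap D x t + Kmap D (target D x t) s)
       *m (invmx (Hjac (target D x t, Kmap D (target D x t) s)) *m b)).
Proof.
move=> Xt Ds DH.
have dK := has_derive_shift (Kmap D x t) (has_derive_Kmap b Xt Ds).
apply: has_derive_eq (has_derive_comp (has_derive_pair (has_derive_cst s b x) dK)
  (has_deriveP _ (smooth_differentiable (@Hmap_smooth _ _ _ D) DH))) _.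
exact: esym (HjacE _ DH).
Qed.

Lemma near_phi_domain x t : domK D x t -> X (target D x t) ->
  \forall s \near (0 : E), domK D (target D x t) s /\
    domH D (x, Kmap D x t + Kmap D (target D x t) s).
Proof.
move=> Dt Xt; apply: filterI; first exact: near_domK Xt (domK0 Xt).
have dK := has_derive_pair (has_derive_cst (0 : E) 0 x)
  (has_derive_shift (Kmap D x t) (has_derive_Kmap0 0 Xt)).
have cK := differentiable_continuous dK.1.
by apply: cK; rewrite (Kmap0 Xt) addr0; exact: near_domH (domH_Kmap Dt).
Qed.

Lemma derive_phi0 x t b : domK D x t -> X (target D x t) ->
  'D_b (phi D x t) 0 = Hjac (x, Kmap D x t) *m (k (target D x t) *m b).
Proof.
move=> Dt Xt; have [Ds DH] := nbhs_singleton (near_phi_domain Dt Xt).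
by rewrite (has_derive_phi b Xt Ds DH).2 (Kmap0 Xt) addr0 kmxE.
Qed.

Lemma has_derive_pairK x l : X x ->
  has_derive 0 l (fun t => (x, Kmap D x t)) (0, k x *m l).
Proof.
by move=> Xx; exact: has_derive_pair (has_derive_cst 0 l x) (has_derive_Kmap0 l Xx).
Qed.

Lemma has_derive_Hjac_Kmap x l : X x ->
  has_derive 0 l (fun t => Hjac (x, Kmap D x t)) ('D_(0, k x *m l) Hjac (x, 0)).
Proof.
move=> Xx; apply: has_derive_comp (has_derive_pairK l Xx) _.
by rewrite (Kmap0 Xx); apply: has_deriveP; exact: differentiable_Hjac (domH0 Xx).
Qed.

Lemma Hjac_kmx x : X x -> Hjac (x, 0) *m k x = 1%:M.
Proof. by move=> Xx; rewrite kmxE mulmxV// -hmxE; exact: hmx_unit. Qed.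

Lemma derive_Hjac_split x u v : X x ->
  'D_(- u, v) Hjac (x, 0) = 'D_(0, v) Hjac (x, 0) - 'D_(u, 0) Hjac (x, 0).
Proof.
move=> Xx; have dH := differentiable_Hjac (domH0 Xx).
have -> : (- u, v) = (0, v) - (u, 0) :> E * E by congr pair; rewrite /= ?sub0r ?subr0.
by apply: etrans (derive_dirD _ _ dH) _; congr (_ + _); exact: derive_dirN.
Qed.

(** Let [P] and [Q] be the vertical and horizontal derivatives of [Hjac] along [k l]. The first
    factor contributes [P k], and [k] at the displaced point contributes [- J k Q k]; since
    [J k = 1] at [t = 0], the sum is [(P - Q) k]. *)
Lemma has_derive_lambda x l b : X x ->
  has_derive 0 l (fun t => Hjac (x, Kmap D x t) *m (k (target D x t) *m b))
    (gamma_mx l x *m b).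
Proof.
move=> Xx; apply: has_derive_eq (has_derive_mulmx (has_derive_Hjac_Kmap l Xx)
  (has_derive_mulmxr b (has_derive_kmx_target l Xx))) _.
rewrite (Kmap0 Xx) (target0 Xx) /gamma_mx (derive_Hjac_split _ _ Xx).
move: ('D_(0, _) _ _) ('D_(_, 0) _ _) => P Q.
by rewrite !mulNmx mulmxN !mulmxA (Hjac_kmx Xx) mul1mx !mulmxBl.
Qed.

Lemma gammaE x l b : X x -> gamma D x l b = gamma_mx l x *m b.
Proof.
move=> Xx; apply: etrans _ (has_derive_lambda l b Xx).2.
apply: near_eq_derive.
apply: filterS (near0_domain Xx).
by move=> t [Dt Xt]; exact: derive_phi0.
Qed.

(** The vertical derivatives cancel by [derive_Hjac_sym]; only the variation of the base point is
    left. *)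
Lemma anholonomyE x l l' : X x -> anholonomy D x l l' =
  'D_(k x *m l', 0) Hjac (x, 0) *m (k x *m l)
  - 'D_(k x *m l, 0) Hjac (x, 0) *m (k x *m l').
Proof.
move=> Xx; rewrite /anholonomy !(gammaE _ _ Xx) /gamma_mx !(derive_Hjac_split _ _ Xx).
have := derive_Hjac_sym (k x *m l') (k x *m l) (domH0 Xx).
move: ('D_(0, k x *m l') _ _) ('D_(0, k x *m l) _ _) => P P'.
move: ('D_(k x *m l', 0) _ _) ('D_(k x *m l, 0) _ _) => Q Q' PP'.
by rewrite -!mulmxA !mulmxBl PP' opprB addrC addrA subrK.
Qed.

(** * Second derivatives of the multiplication and the curvature *)

Lemma derive_phi2 x t a b : domK D x t -> X (target D x t) ->
  'D_a (fun s => 'D_b (fun t' => phi D x t t') s) 0 =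
  ('D_(0, k (target D x t) *m a) Hjac (x, Kmap D x t)
   - Hjac (x, Kmap D x t) *m k (target D x t)
     *m 'D_(0, k (target D x t) *m a) Hjac (target D x t, 0))
  *m (k (target D x t) *m b).
Proof.
move=> Dt Xt; set x' := target D x t in Xt *.
have near0 := near_phi_domain Dt Xt.
have DH := domH_Kmap Dt.
have dK := has_derive_pair (has_derive_cst 0 a x)
  (has_derive_shift (Kmap D x t) (has_derive_Kmap0 a Xt)).
have K0 : Kmap D x t + Kmap D x' 0 = Kmap D x t by rewrite (Kmap0 Xt) addr0.
have dH : has_derive 0 a (fun s => Hjac (x, Kmap D x t + Kmap D x' s))
    ('D_(0, k x' *m a) Hjac (x, Kmap D x t)).
  apply: has_derive_comp dK _.
  by rewrite K0; apply: has_deriveP; exact: differentiable_Hjac.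
have uH : Hjac (x', Kmap D x' 0) \in unitmx := Hjac_unit Xt (domK0 Xt).
have dI := has_derive_invmx (has_derive_Hjac_Kmap a Xt) uH.
have [_ dP] := has_derive_mulmx dH (has_derive_mulmxr b dI).
apply: etrans _ (etrans dP _).
  apply: near_eq_derive; apply: filterS near0.
  move=> s [Ds DHs].
  exact: (has_derive_phi b Xt Ds DHs).2.
rewrite K0 (Kmap0 Xt) -kmxE.
move: ('D_(0, _) _ _) ('D_(0, _) _ _) => P Q.
by rewrite mulmxBl mulNmx mulmxN !mulmxA.
Qed.

(** The difference in [derive_phi2] vanishes at [t = 0], where [J k = 1], so only its own derivative
    counts. The terms that vary the direction [k a] occur twice with opposite signs. *)
Lemma rhoE x l a b : X x -> rho D x l a b =
  ('D_(0, k x *m l) ('D_(0, k x *m a) Hjac) (x, 0)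
   - gamma_mx l x *m 'D_(0, k x *m a) Hjac (x, 0)
   - 'D_(k x *m l, 0) ('D_(0, k x *m a) Hjac) (x, 0)) *m (k x *m b).
Proof.
move=> Xx; have DH := domH0 Xx.
pose u := k x *m l; pose da := - (k x *m 'D_(u, 0) Hjac (x, 0) *m k x) *m a.
have dka : has_derive 0 l (fun t => k (target D x t) *m a) da.
  exact: has_derive_mulmxr (has_derive_kmx_target l Xx).
(* The regularity premises stay open until [Kmap0] and [target0] have turned the base points into
   [(x, 0)]. *)
have d1 := has_derive_dir (G := Hjac) linear_pair0l _ _ (has_derive_pairK l Xx) dka.
have dt0 := has_derive_pair (has_derive_target0 l Xx) (has_derive_cst 0 l (0 : E)).
have d2 := has_derive_dir (G := Hjac) linear_pair0l _ _ dt0 dka.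
rewrite /= (Kmap0 Xx) (target0 Xx) in d1 d2.
have dG := near_differentiable_Hjac DH.
have d2G := fun w => differentiable_derive_Hjac w DH.
have {}d1 := d1 dG d2G; have {}d2 := d2 dG d2G.
have dhk := has_derive_mulmx (has_derive_Hjac_Kmap l Xx) (has_derive_kmx_target l Xx).
have dkb := has_derive_mulmxr b (has_derive_kmx_target l Xx).
have [_ dP] := has_derive_mulmx (has_deriveB d1 (has_derive_mulmx dhk d2)) dkb.
apply: etrans _ (etrans dP _).
  apply: near_eq_derive.
  by apply: filterS (near0_domain Xx) => t [Dt Xt]; exact: derive_phi2.
rewrite (Kmap0 Xx) (target0 Xx) (Hjac_kmx Xx).
rewrite /gamma_mx (derive_Hjac_split _ _ Xx) -/u.
move: ('D_(0, u) ('D_(0, k x *m a) Hjac) (x, 0))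
      ('D_(u, 0) ('D_(0, k x *m a) Hjac) (x, 0)) => S1 S2.
move: ('D_(0, da) Hjac (x, 0)) ('D_(0, k x *m a) Hjac (x, 0)) => P1 P2.
rewrite /da; move: ('D_(0, u) Hjac (x, 0)) ('D_(u, 0) Hjac (x, 0)) => P3 P4.
rewrite !mul1mx subrr mul0mx addr0; congr (_ *m _).
rewrite mulmxN !mulmxA (Hjac_kmx Xx) mul1mx mulmxDl mulNmx !mulmxBl.
move: (P3 *m k x *m P2) (P4 *m k x *m P2) => P5 P6.
by apply/matrixP => i j; rewrite !mxE; ring.
Qed.

Lemma derive2_Hjac_split x w u v : X x ->
  'D_w ('D_(- u, v) Hjac) (x, 0) =
  'D_w ('D_(0, v) Hjac) (x, 0) - 'D_w ('D_(u, 0) Hjac) (x, 0).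
Proof.
move=> Xx; have DH := domH0 Xx.
have dG := near_differentiable_Hjac DH.
have d2G := fun w => differentiable_derive_Hjac w DH.
have -> : (- u, v) = (0, v) - (u, 0) :> E * E by congr pair; rewrite /= ?sub0r ?subr0.
apply: etrans (derive2_dirD dG d2G _ _ _) _; congr (_ + _).
exact: derive2_dirN.
Qed.

Lemma has_derive_gamma_mx l x v : X x ->
  has_derive x v (gamma_mx l)
    (let dk := - (k x *m 'D_(v, 0) Hjac (x, 0) *m k x) in
     let Psi w := 'D_(- w, w) Hjac in
     ('D_(v, 0) (Psi (k x *m l)) (x, 0) + Psi (dk *m l) (x, 0)) *m k x
     + Psi (k x *m l) (x, 0) *m dk).
Proof.
move=> Xx; have DH := domH0 Xx.
have dkl := has_derive_mulmxr l (has_derive_kmx v Xx).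
have dx0 := has_derive_pair (has_derive_id x v) (has_derive_cst x v (0 : E)).
have dPsi := has_derive_dir (G := Hjac) linear_pairN
  (near_differentiable_Hjac DH) (fun w => differentiable_derive_Hjac w DH) dx0 dkl.
exact: has_derive_mulmx dPsi (has_derive_kmx v Xx).
Qed.

Lemma derive_kmx x v : X x ->
  'D_v k x = - (k x *m 'D_(v, 0) Hjac (x, 0) *m k x).
Proof. by move=> Xx; exact: (has_derive_kmx v Xx).2. Qed.

(** The right-hand side is the Lie bracket of the frame fields [k l] and [k l'], so this is
    [[e_l, e_l'] = e_C]. As it involves [k] alone, it serves later to compare two deformations. *)
Lemma kmx_anholonomy x l l' : X x -> k x *m anholonomy D x l l' =
  'D_(k x *m l) k x *m l' - 'D_(k x *m l') k x *m l.
Proof.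
move=> Xx; rewrite (anholonomyE _ _ Xx).
apply: etrans _ (congr2 (fun A B => A *m l' - B *m l)
  (esym (derive_kmx _ Xx)) (esym (derive_kmx _ Xx))).
move: ('D_(k x *m l', 0) _ _) ('D_(k x *m l, 0) _ _) => Q Q'.
by rewrite mulmxBr !mulNmx !mulmxA opprK addrC.
Qed.

(** The right-hand side is the classical curvature of the connection matrices [gamma_mx] in a
    nonholonomic frame. The pure second derivatives of [Hjac] cancel by symmetry, and the mixed ones
    occur identically on both sides. *)
Lemma curvatureE x th l l' : X x -> curvature D x th l l' =
  ('D_(k x *m l) (gamma_mx l') x - 'D_(k x *m l') (gamma_mx l) x
   + gamma_mx l x *m gamma_mx l' x - gamma_mx l' x *m gamma_mx l x
   - gamma_mx (anholonomy D x l l') x) *m th.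
Proof.
move=> Xx; have DH := domH0 Xx; have dH := differentiable_Hjac DH.
rewrite /curvature (rhoE _ _ _ Xx) (rhoE _ _ _ Xx).
rewrite [X in _ = (X - _ + _ - _ - _) *m _](has_derive_gamma_mx l' (k x *m l) Xx).2.
rewrite [X in _ = (_ - X + _ - _ - _) *m _](has_derive_gamma_mx l (k x *m l') Xx).2.
cbv zeta.
rewrite [X in _ = (((X + _) *m _ + _) - _ + _ - _ - _) *m _](derive2_Hjac_split _ _ _ Xx).
rewrite [X in _ = (_ - ((X + _) *m _ + _) + _ - _ - _) *m _](derive2_Hjac_split _ _ _ Xx).
have S1 := derive2_Hjac_sym (0, k x *m l) (0, k x *m l') DH.
have S2 := derive2_Hjac_sym (k x *m l, 0) (k x *m l', 0) DH.
(* By [kmx_anholonomy], the term in the anholonomy object splits into the two terms that arise from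
   differentiating [k] inside the directions of [gamma_mx l'] and [gamma_mx l]. *)
have EC : gamma_mx (anholonomy D x l l') x =
    ('D_(- (- (k x *m 'D_(k x *m l, 0) Hjac (x, 0) *m k x) *m l'),
         - (k x *m 'D_(k x *m l, 0) Hjac (x, 0) *m k x) *m l') Hjac (x, 0)
    - 'D_(- (- (k x *m 'D_(k x *m l', 0) Hjac (x, 0) *m k x) *m l),
         - (k x *m 'D_(k x *m l', 0) Hjac (x, 0) *m k x) *m l) Hjac (x, 0)) *m k x.
  rewrite /gamma_mx (kmx_anholonomy _ _ Xx) !(derive_kmx _ Xx); congr (_ *m _).
  move: ('D_(k x *m l', 0) _ _) ('D_(k x *m l, 0) _ _) => Q Q'.
  rewrite -(derive_dirN _ dH) -(derive_dirD _ _ dH).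
  by congr ('D_ _ Hjac (x, 0)); congr pair; rewrite /= ?opprD.
rewrite EC; move: EC => _.
rewrite /gamma_mx (derive_Hjac_split _ _ Xx) (derive_Hjac_split _ _ Xx).
exact: curvature_algebra S1 S2.
Qed.

(** * The commutator of covariant derivatives *)

Section Nabla.
Variables (tau : E -> E).
Hypothesis smooth_tau : smooth X tau.

Lemma nablaE l x : X x ->
  nabla D l tau x = 'D_(k x *m l) tau x + gamma_mx l x *m tau x.
Proof. by move=> Xx; rewrite /nabla (gammaE _ _ Xx). Qed.

Lemma has_derive_nabla l x v : X x -> has_derive x v (nabla D l tau)
  ('D_v ('D_(k x *m l) tau) x + 'D_('D_v k x *m l) tau x
   + ('D_v (gamma_mx l) x *m tau x + gamma_mx l x *m 'D_v tau x)).
Proof.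
move=> Xx.
have dtau y : X y -> differentiable tau y by exact: smooth_differentiable.
have d2tau w : differentiable ('D_w tau) x.
  exact: smooth_differentiable (smooth_derive w smooth_tau) Xx.
have dk := has_deriveP v (has_derive_kmx v Xx).1.
have dg := has_deriveP v (has_derive_gamma_mx l v Xx).1.
have linid : linear (id : E -> E) by [].
have dn : \forall y \near x, differentiable tau y by apply: filterS (near_X Xx).
have d1 := has_derive_dir (G := tau) linid dn d2tau (has_derive_id x v)
  (has_derive_mulmxr l dk).
apply: has_derive_near (has_deriveD d1 (has_derive_mulmx dg (has_deriveP v (dtau x Xx)))).
by apply: filterS (near_X Xx) => y Xy; rewrite nablaE.
Qed.

(** The second derivatives of [tau] commute, and the terms with a derivative of [k] form [e_C tau]
    by [kmx_anholonomy]. The terms of order zero in [tau] give the curvature once the part in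
    [gamma_C] is split off. *)
Lemma nabla_commutator l l' x : X x ->
  nabla D l (nabla D l' tau) x - nabla D l' (nabla D l tau) x =
  nabla D (anholonomy D x l l') tau x + curvature D x (tau x) l l'.
Proof.
move=> Xx.
have dtau : differentiable tau x by exact: smooth_differentiable Xx.
have dn : \forall y \near x, differentiable tau y.
  by apply: filterS (near_X Xx) => y; exact: smooth_differentiable.
have d2tau w : differentiable ('D_w tau) x.
  exact: smooth_differentiable (smooth_derive w smooth_tau) Xx.
have sym := derive_symmetry dn (d2tau (k x *m l)) (d2tau (k x *m l')).
have n2 m m' : nabla D m (nabla D m' tau) x =
    ('D_(k x *m m) ('D_(k x *m m') tau) x + 'D_('D_(k x *m m) k x *m m') tau x
     + ('D_(k x *m m) (gamma_mx m') x *m tau x + gamma_mx m' x *m 'D_(k x *m m) tau x))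
    + gamma_mx m x *m ('D_(k x *m m') tau x + gamma_mx m' x *m tau x).
  apply: etrans (congr2 +%R (has_derive_nabla m' (k x *m m) Xx).2 (gammaE m _ Xx)) _.
  by rewrite (nablaE _ Xx).
rewrite (n2 l l') (n2 l' l) (nablaE _ Xx) (kmx_anholonomy _ _ Xx) (curvatureE _ _ _ Xx).
rewrite (derive_dirD _ _ dtau) (derive_dirN _ dtau).
exact: nabla_algebra sym.
Qed.

End Nabla.

End Deformations.

(** * Motions of the tangent bundle *)

Lemma sigma_algebra (R : comPzRingType) n (s s' d d' g g' p p' : 'M[R]_n) : s = s' ->
  p + d - s' - g - (p' + d' - s - g') = d - d' + p - p' - (g - g').
Proof.
by move=> ->; apply/matrixP => i j; rewrite !mxE; ring.
Qed.

Section Motions.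
Context {R : realType} {n : nat} {X : set 'cV[R]_n} {eta : 'M[R]_n}.
Hypothesis oX : open X.
Variable G : bundle_motions X eta.
Local Notation E := 'cV[R]_n.
Local Notation k := (kmx G).
Implicit Types (x l t : E).

Let Pi (p : E * E) := pi_ G p.1 p.2.

Definition dpi l x : 'M[R]_n := 'D_(0, l) Pi (x, 0).

Let smoothPi : smooth (domP G) Pi := @pi_smooth _ _ _ _ G.

Lemma near_domP p : domP G p -> \forall q \near p, domP G q.
Proof. by move=> Dp; apply: open_nbhs_nbhs; split=> //; exact: domP_open. Qed.

Lemma differentiable_Pi p : domP G p -> differentiable Pi p.
Proof. exact: smooth_differentiable. Qed.

Lemma differentiable_derive_Pi p w : domP G p -> differentiable ('D_w Pi) p.
Proof. exact: smooth_differentiable (smooth_derive w smoothPi). Qed.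

Lemma derive2_Pi_sym p (u v : E * E) : domP G p ->
  'D_v ('D_u Pi) p = 'D_u ('D_v Pi) p.
Proof.
move=> Dp; apply: derive_symmetry; last 2 first.
- exact: differentiable_derive_Pi.
- exact: differentiable_derive_Pi.
by apply: filterS (near_domP Dp) => q; exact: differentiable_Pi.
Qed.

Lemma derive_pi0 x l : 'D_l (pi_ G x) 0 = dpi l x.
Proof. exact: derive_partial2. Qed.

Lemma has_derive_pi x t l : domP G (x, t) ->
  has_derive t l (pi_ G x) ('D_(0, l) Pi (x, t)).
Proof.
move=> Dt; exact: (has_derive_comp
  (has_derive_pair (has_derive_cst t l x) (has_derive_id t l))
  (has_deriveP (0, l) (differentiable_Pi Dt))).
Qed.

Lemma near_pi_domain x : X x -> \forall t \near (0 : E),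
  [/\ domK G x t, X (target G x t), domP G (x, t) & pi_ G x t \in unitmx].
Proof.
move=> Xx; have Dp := domP_zero G Xx.
have n1 := near0_domain G oX Xx.
have cx := differentiable_continuous
  (has_derive_pair (has_derive_cst 0 0 x) (has_derive_id (0 : E) 0)).1.
have n2 : \forall t \near (0 : E), domP G (x, t) by apply: cx; exact: near_domP.
have u0 : pi_ G x 0 \in unitmx by rewrite (pi_zero G Xx) unitmx1.
have n3 := near_unitmx (differentiable_continuous (has_derive_pi 0 Dp).1) u0.
apply: filterS3 n1 n2 n3.
by move=> t [].
Qed.

Lemma phi0 x t : domK G x t -> X (target G x t) -> phi G x t 0 = t.
Proof. by move=> Dt Xt; rewrite /phi (Kmap0 G Xt) addr0 KmapK. Qed.

Lemma has_derive_act (tau : E -> E) (xi : E * 'M[R]_n) x :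
  X x -> differentiable tau x ->
  has_derive unitTR xi (fun th => act_TX G (fun=> th) tau x)
    (xi.2 *m tau x + dpi xi.1 x *m tau x + 'D_(k x *m xi.1) tau x).
Proof.
move=> Xx dtau; have Dp := domP_zero G Xx.
have h1 := has_derive_fst (unitTR : E * 'M[R]_n) xi.
have h2 := has_derive_snd (unitTR : E * 'M[R]_n) xi.
have hp := has_derive_comp h1 (has_derive_pi xi.1 Dp).
have ht := has_derive_comp h1 (has_derive_target0 G xi.1 Xx).
have dtau' : differentiable tau (target G x (unitTR : E * 'M[R]_n).1).
  by rewrite /= (target0 G Xx).
have htau := has_derive_comp ht (has_deriveP (k x *m xi.1) dtau').
apply: has_derive_eq (has_derive_mulmx (has_derive_mulmx h2 hp) htau) _.
rewrite /= (target0 G Xx) (pi_zero G Xx) -/(dpi xi.1 x).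
move: (dpi _ _) ('D_ _ _ _) => a b.
by rewrite !mulmx1 !mul1mx mulmxDl.
Qed.

(** By [derive_phi0], the matrix of the derivative of [phi G x t] at 0, which is the translation
    part of [Lambda]. *)
Definition lambda_mx x t := Hjac G (x, Kmap G x t) *m k (target G x t).

(** The rotation part of [Lambda] at [(t, 1)] on [(l, 0)]: the two terms come from [pi_] at the
    displaced point and from the inverse of [pi_] at the product. *)
Definition omega l x t : 'M[R]_n :=
  pi_ G x t *m dpi l (target G x t) *m invmx (pi_ G x t)
  - 'D_(0, lambda_mx x t *m l) Pi (x, t) *m invmx (pi_ G x t).

(** Since [phi G x t 0 = t], the last factor of [PhiR] at the unit is the inverse of [pi_ G x t];
    the left factor [th.2] is untouched by the differentiation. *)
Lemma Lambda_translation x l (th : E * 'M[R]_n) :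
  domK G x th.1 -> X (target G x th.1) -> domP G (x, th.1) ->
  pi_ G x th.1 \in unitmx ->
  Lambda G x th (l, 0) = (lambda_mx x th.1 *m l, th.2 *m omega l x th.1).
Proof.
case: th => t r /= Dt Xt Dp u; set x' := target G x t in Xt *.
have [Ds DH] := nbhs_singleton (near_phi_domain Dt Xt).
have h1 := has_derive_fst (unitTR : E * 'M[R]_n) (l, 0).
have h2 := has_derive_snd (unitTR : E * 'M[R]_n) (l, 0).
have hphi : has_derive 0 l (phi G x t) (lambda_mx x t *m l).
  apply: has_derive_eq (has_derive_phi l Xt Ds DH) _.
  by rewrite (Kmap0 G Xt) addr0 -kmxE mulmxA.
have hT := has_derive_comp h1 hphi.
have hpi' := has_derive_comp h1 (has_derive_pi l (domP_zero G Xt)).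
have u' : pi_ G x (phi G x t 0) \in unitmx by rewrite (phi0 Dt Xt).
have Dp' : domP G (x, phi G x t 0) by rewrite (phi0 Dt Xt).
have hpi := has_derive_comp hT (has_derive_pi (lambda_mx x t *m l) Dp').
have hinv := has_derive_invmx hpi u'.
have hR := has_derive_mulmx
  (has_derive_mulmx (has_derive_mulmxl (r *m pi_ G x t) h2) hpi') hinv.
apply: etrans (has_derive_pair hT hR).2 _; congr pair.
rewrite /= (phi0 Dt Xt) (pi_zero G Xt) /omega -/(dpi l x') -/x'.
move: (dpi l x') ('D_ _ _ _) => a b.
by rewrite mulmx0 mul0mx add0r !mulmx1 mulmxN !mulmxA mulmxK// mulmxBr !mulmxA.
Qed.

Lemma dpiB x l l' : X x -> dpi (l - l') x = dpi l x - dpi l' x.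
Proof.
move=> Xx; have dP := differentiable_Pi (domP_zero G Xx).
rewrite /dpi; have -> : (0, l - l') = (0, l) - (0, l') :> E * E.
  by congr pair; rewrite /= subr0.
by apply: etrans (derive_dirD _ _ dP) _; congr (_ + _); exact: derive_dirN.
Qed.

Lemma has_derive_dpi l x v : X x ->
  has_derive x v (dpi l) ('D_(v, 0) ('D_(0, l) Pi) (x, 0)).
Proof.
move=> Xx; have dx0 := has_derive_pair (has_derive_id x v) (has_derive_cst x v (0 : E)).
exact: (has_derive_comp dx0
  (has_deriveP (v, 0) (differentiable_derive_Pi (0, l) (domP_zero G Xx)))).
Qed.

Lemma has_derive_lambda_mx x l (b : E) : X x ->
  has_derive 0 l (fun t => lambda_mx x t *m b) (gamma_mx G l x *m b).
Proof.
move=> Xx; rewrite (_ : (fun t => _) =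
    fun t => Hjac G (x, Kmap G x t) *m (k (target G x t) *m b)).
  exact: has_derive_lambda.
by apply/funext => t; rewrite /lambda_mx mulmxA.
Qed.

Lemma lambda_mx0 x : X x -> lambda_mx x 0 = 1%:M.
Proof. by move=> Xx; rewrite /lambda_mx (Kmap0 G Xx) (target0 G Xx) Hjac_kmx. Qed.

(** The two inverses contribute [dpi l' x *m dpi l x] with opposite signs, so this product cancels.
    The last term comes from the variation of the direction [lambda_mx x t *m l']. *)
Lemma has_derive_omega x l l' : X x ->
  has_derive 0 l (omega l' x)
    (dpi l x *m dpi l' x + 'D_(k x *m l) (dpi l') x
     - 'D_(0, l) ('D_(0, l') Pi) (x, 0) - dpi (gamma_mx G l x *m l') x).
Proof.
move=> Xx; have Dp := domP_zero G Xx.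
have hp := has_derive_pi l Dp.
have u : pi_ G x 0 \in unitmx by rewrite (pi_zero G Xx) unitmx1.
have hi := has_derive_invmx hp u.
have d0 := has_derive_dpi l' (k x *m l) (x := x) Xx.
have hd : has_derive 0 l (fun t => dpi l' (target G x t)) ('D_(k x *m l) (dpi l') x).
  apply: has_derive_comp (has_derive_target0 G l Xx) _.
  by rewrite (target0 G Xx); exact: has_deriveP d0.1.
have hx := has_derive_pair (has_derive_cst 0 l x) (has_derive_id (0 : E) l).
have nd : \forall z \near (x, 0 : E), differentiable Pi z.
  by apply: filterS (near_domP Dp) => q; exact: differentiable_Pi.
have hD := has_derive_dir (G := Pi) linear_pair0l nd
  (fun w => differentiable_derive_Pi w Dp) hx (has_derive_lambda_mx l l' Xx).
apply: has_derive_eq (has_deriveB (has_derive_mulmx (has_derive_mulmx hp hd) hi)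
  (has_derive_mulmx hD hi)) _.
rewrite /= (lambda_mx0 Xx) (target0 G Xx) (pi_zero G Xx) (mul1mx l').
rewrite -/(dpi l x) -/(dpi l' x) -/(dpi (gamma_mx G l x *m l') x).
move: ('D_(0, l) ('D_(0, l') Pi) (x, 0)) (dpi (_ *m _) _) ('D_(k x *m l) _ _) => S g D.
move: (dpi l x) (dpi l' x) => P P'.
have -> : invmx 1%:M = 1%:M :> 'M[R]_n by rewrite -[RHS](mulVmx (unitmx1 _ _)) mulmx1.
rewrite !mul1mx !mulmx1 !mulmxN.
move: (P *m P') (P' *m P) => a b.
by apply/matrixP => i j; rewrite !mxE; ring.
Qed.

Lemma near_unitTR x : X x -> \forall th \near (unitTR : E * 'M[R]_n),
  [/\ domK G x th.1, X (target G x th.1), domP G (x, th.1)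
    & pi_ G x th.1 \in unitmx].
Proof.
move=> Xx; have cf := differentiable_continuous
  (has_derive_fst (unitTR : E * 'M[R]_n) 0).1.
exact: cf (near_pi_domain Xx).
Qed.

Lemma derive_Lambda_translation x l l' : X x ->
  'D_(l, 0) (fun th => Lambda G x th (l', 0)) (unitTR : E * 'M[R]_n) =
  (gamma_mx G l x *m l',
   dpi l x *m dpi l' x + 'D_(k x *m l) (dpi l') x
   - 'D_(0, l) ('D_(0, l') Pi) (x, 0) - dpi (gamma_mx G l x *m l') x).
Proof.
move=> Xx.
have h1 := has_derive_fst (unitTR : E * 'M[R]_n) (l, 0).
have h2 := has_derive_snd (unitTR : E * 'M[R]_n) (l, 0).
have hT := has_derive_comp h1 (has_derive_lambda_mx l l' Xx).
have hR := has_derive_mulmx h2 (has_derive_comp h1 (has_derive_omega l l' Xx)).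
apply: etrans _ (etrans (has_derive_pair hT hR).2 _).
  apply: near_eq_derive; apply: filterS (near_unitTR Xx).
  by move=> th [Dt Xt Dp u]; exact: Lambda_translation.
by congr pair; rewrite /= mul0mx add0r mul1mx.
Qed.

(** Antisymmetrizing removes the second derivatives of [pi_], and linearity of [dpi] collects the
    [gamma] terms into the anholonomy object. The result is the expression of [curvatureE] with
    [dpi] in place of [gamma_mx]. *)
Lemma Sigma_translation x l l' : X x ->
  Sigma G x (l, 0) (l', 0) =
  (anholonomy G x l l',
   'D_(k x *m l) (dpi l') x - 'D_(k x *m l') (dpi l) x
   + dpi l x *m dpi l' x - dpi l' x *m dpi l x
   - dpi (anholonomy G x l l') x).
Proof.
move=> Xx; apply: etrans (congr2 (fun a b => a - b)
  (derive_Lambda_translation l l' Xx) (derive_Lambda_translation l' l Xx)) _.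
rewrite /anholonomy (gammaE G oX _ _ Xx) (gammaE G oX _ _ Xx); congr pair.
rewrite (dpiB _ _ Xx) /=.
exact: sigma_algebra (derive2_Pi_sym (0, l) (0, l') (domP_zero G Xx)).
Qed.

(** * Consistency with the Riemannian translations *)

Section Associated.
Variable RT : riemannian_translations X eta.
Hypothesis assoc : associated G RT.

Lemma kmx_associated x : X x -> k x = kmx RT x.
Proof.
move=> Xx; apply: mulmx_cV_inj => l.
by rewrite -(derive_Kmap0 G l Xx) (assoc Xx).1.
Qed.

Lemma dpi_associated l x : X x -> dpi l x = gamma_mx RT l x.
Proof.
move=> Xx; apply: mulmx_cV_inj => th.
by rewrite -derive_pi0 (assoc Xx).2 gammaE.
Qed.

Lemma derive_dpi_associated l x v : X x -> 'D_v (dpi l) x = 'D_v (gamma_mx RT l) x.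
Proof.
move=> Xx; apply: near_eq_derive.
by apply: filterS (near_X oX Xx) => y; exact: dpi_associated.
Qed.

(** Association compares first derivatives of the two deformations, not their [gamma]. By
    [kmx_anholonomy], however, the anholonomy object is determined by [k] near [x], which the two
    share. *)
Lemma anholonomy_associated x l l' : X x ->
  anholonomy G x l l' = anholonomy RT x l l'.
Proof.
move=> Xx; have u : k x \in unitmx by rewrite unitmx_inv; exact: hmx_unit.
apply: (can_inj (mulKmx u)).
have E v : 'D_v k x = 'D_v (kmx RT) x.
  apply: near_eq_derive.
  by apply: filterS (near_X oX Xx) => y; exact: kmx_associated.
apply: etrans (kmx_anholonomy G oX _ _ Xx) _; rewrite (kmx_associated Xx).
apply: etrans _ (esym (kmx_anholonomy RT oX _ _ Xx)).
exact (congr2 (fun A B : 'M[R]_n => A *m l' - B *m l)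
  (E (kmx RT x *m l)) (E (kmx RT x *m l'))).
Qed.

Lemma generatorE (tau : E -> E) (xi : E -> E * 'M[R]_n) x :
  X x -> differentiable tau x ->
  generator G xi tau x = (xi x).2 *m tau x + nabla RT (xi x).1 tau x.
Proof.
move=> Xx dtau; apply: etrans (has_derive_act (xi x) Xx dtau).2 _.
rewrite (nablaE RT oX _ _ Xx) (dpi_associated _ Xx) (kmx_associated Xx).
by rewrite -addrA [gamma_mx _ _ _ *m _ + _]addrC.
Qed.

Lemma Sigma_associated x l l' : X x ->
  (Sigma G x (l, 0) (l', 0)).1 = anholonomy RT x l l' /\
  forall th, (Sigma G x (l, 0) (l', 0)).2 *m th = curvature RT x th l l'.
Proof.
move=> Xx; rewrite (Sigma_translation _ _ Xx) /= (anholonomy_associated _ _ Xx).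
split=> // th; rewrite (curvatureE RT oX _ _ _ Xx).
rewrite -!(dpi_associated _ Xx) -(kmx_associated Xx).
exact (congr2 (fun A B : 'M[R]_n => (A - B + dpi l x *m dpi l' x
    - dpi l' x *m dpi l x - dpi (anholonomy RT x l l') x) *m th)
  (derive_dpi_associated l' (k x *m l) Xx) (derive_dpi_associated l (k x *m l') Xx)).
Qed.

End Associated.

End Motions.

Theorem theorem3 (R : realType) (n : nat) (X : set 'cV[R]_n) (eta : 'M[R]_n)
    (hX : open X) (heta : euclidean_metric eta)
    (RT : riemannian_translations X eta)
    (DR : bundle_motions X eta) (hDR : associated DR RT) :
  (* (i) *)
  (forall (l : 'cV[R]_n) (tau : 'cV[R]_n -> 'cV[R]_n) (x : 'cV[R]_n),
     smooth X tau -> X x ->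
     generator DR (fun=> (l, 0)) tau x = nabla RT l tau x) /\
  (* (ii) *)
  (forall l l' x : 'cV[R]_n, X x ->
     (Sigma DR x (l, 0) (l', 0)).1 = anholonomy RT x l l' /\
     forall theta : 'cV[R]_n,
       (Sigma DR x (l, 0) (l', 0)).2 *m theta = curvature RT x theta l l') /\
  (* (iii) *)
  (forall (l l' : 'cV[R]_n) (tau : 'cV[R]_n -> 'cV[R]_n) (x : 'cV[R]_n),
     smooth X tau -> X x ->
     nabla RT l (nabla RT l' tau) x - nabla RT l' (nabla RT l tau) x
       = nabla RT (anholonomy RT x l l') tau x
         + curvature RT x (tau x) l l' /\
     generator DR (fun=> (l, 0)) (generator DR (fun=> (l', 0)) tau) x
       - generator DR (fun=> (l', 0)) (generator DR (fun=> (l, 0)) tau) x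
       = generator DR (fun y => Sigma DR y (l, 0) (l', 0)) tau x).
Proof.
(* Stated for fields differentiable at [x], so that it can be applied again to the output of a
   generator. *)
have gen l (tau : 'cV[R]_n -> 'cV[R]_n) x : X x -> differentiable tau x ->
    generator DR (fun=> (l, 0)) tau x = nabla RT l tau x.
  by move=> Xx dtau; rewrite (generatorE hX hDR _ Xx dtau)/= mul0mx add0r.
split=> [l tau x stau Xx|]; first exact: gen Xx (smooth_differentiable stau Xx).
split=> [l l' x Xx|l l' tau x stau Xx]; first exact: Sigma_associated.
have gen2 m m' : generator DR (fun=> (m, 0)) (generator DR (fun=> (m', 0)) tau) x
    = nabla RT m (nabla RT m' tau) x.
  (* The two operators agree on the open set [X], hence near [x], so their outputs have the same
     derivatives at [x]. *)
  have E : \forall y \near x, generator DR (fun=> (m', 0)) tau y = nabla RT m' tau y.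
    apply: filterS (near_X hX Xx) => y Xy.
    exact: gen Xy (smooth_differentiable stau Xy).
  have E' : \forall y \near x, nabla RT m' tau y = generator DR (fun=> (m', 0)) tau y.
    by apply: filterS E => y ->.
  apply: etrans (gen _ _ _ Xx _) _.
    by apply: near_eq_differentiable E' _; exact: (has_derive_nabla RT hX stau m' 0 Xx).1.
  exact (congr2 (fun a b : 'cV[R]_n => a + b)
    (near_eq_derive (kmx RT x *m m) E) (congr1 (gamma RT x m) (nbhs_singleton E))).
have comm := nabla_commutator RT hX stau l l' Xx; split=> //.
apply: etrans (congr2 (fun a b => a - b) (gen2 l l') (gen2 l' l)) _.
apply: etrans comm _; apply: etrans _ (esym (generatorE hX hDR _ Xx
  (smooth_differentiable stau Xx))).
(* The generator of [Sigma] is its rotation part applied to [tau] plus [nabla] along its translation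
   part, which is the right-hand side of [comm]. *)
have [S1 S2] := Sigma_associated hX hDR l l' Xx.
by rewrite S1 S2 addrC.
Qed.
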